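(* Let $v$ be the value function and let $b^{*}:[0,\infty)\to[0,1]$ be a measurable function such that for all $z\ge 0$ $$\mathbb E\bigl[e^{-rT_1}\,v(\Delta_z^{b^{*}(z)}(T_1))\bigr]=\inf_{b\in[0,1]} \mathbb E\bigl[e^{-rT_1}\,v(\Delta_z^b(T_1))\bigr].$$ For initial drawdown $z\ge0$ let $B^{*}$ be the strategy given by $$B_t^{*} = b^{*}\bigl(\Delta_{z}^{B^{*}}(T_{N_t})\bigr),\qquad t\ge 0 .$$ Then $B^{*}$ is optimal, that is, $v(z)=\inf_{B\in\mathcal B}v^{B}(z)=v^{B^{*}}(z)$ for all $z\geq 0$.
   Context: Setting. On a complete probability space $(\Omega,\mathcal F,\mathbb P)$ let $W$ be a standard Brownian motion and $N=\{N_t\}_{t\ge0}$ an ordinary renewal process independent of $W$, with arrival times $0=T_0<T_1<T_2<\cdots$, whose i.i.d. strictly positive interarrival times $T_{k+1}-T_k$ have an arbitrary common distribution. $N_t$ is the index $k$ with $T_k\le t<T_{k+1}$, so $T_{N_t}$ is the last arrival time up to $t$. $\{\mathcal F_t\}_{t\ge 0}$ is the smallest right-continuous filtration to which $W$ and $N$ are adapted. Fix real constants $\eta<\theta$, $\sigma>0$, a critical level $d>0$ and a discount rate $r>0$. For $b\in[0,1]$ put $\mu(b)=\eta-(1-b)\theta$ and $\sigma(b)=\sigma b$. Strategies. $\mathcal B$ is the set of all processes $B_t=\sum_{k=0}^\infty b_k\mathbf 1_{[T_k,T_{k+1})}(t)=b_{N_t}$, where each $b_k$ is an $\mathcal F_{T_k}$-measurable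 random variable with values in $[0,1]$. Drawdown. For $B\in\mathcal B$ let $X_0^B(t)=\int_0^t\mu(B_s)\,ds+\int_0^t\sigma(B_s)\,dW_s$. For $z\ge0$ the drawdown process with initial drawdown $z$ is $\Delta_z^B(t)=\max\{z,\sup_{0\le s\le t}X_0^B(s)\}-X_0^B(t)$. For constant $b\in[0,1]$, $\Delta_z^b$ denotes $\Delta_z^B$ with $B_t=b$ for all $t$. In an expression such as $\Delta_z^{b^*(z)}$ the number $b^*(z)$ is used as a constant strategy. The strategy $B^*$ (which depends on $z$) is defined recursively over the intervals $[T_k,T_{k+1})$: on $[T_k,T_{k+1})$ it equals $b^*$ evaluated at the drawdown observed at $T_k$. Value function. $v^B(z)=\mathbb E\bigl[\sum_{k=0}^\infty e^{-rT_k}\mathbf 1_{\{\Delta_z^B(T_k)>d\}}\bigr]$ and $v(z)=\inf_{B\in\mathcal B}v^B(z)$ for $z\ge0$. *)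

(* Defs.v *)
From mathcomp Require Import all_boot all_order all_algebra.
From mathcomp Require Import all_classical all_reals all_analysis.
Import Order.TTheory GRing.Theory Num.Theory.
Import numFieldNormedType.Exports.

Set Implicit Arguments.
Unset Strict Implicit.
Unset Printing Implicit Defensive.

Local Open Scope classical_set_scope.
Local Open Scope ring_scope.

(* Processes are indexed by the whole of [R]; only the times [0 <= t] are
   meaningful, and every definition below restricts to them. *)

(* Mutual independence of a family of real random variables. *)
Definition mutually_independent d (Om : measurableType d) (R : realType)
    (P : probability Om R) (I : eqType) (X : I -> Om -> R) : Prop :=
  forall (s : seq I) (A : I -> set R), uniq s ->
    (forall i, measurable (A i)) ->
    P (\bigcap_(i in [set` s]) (X i @^-1` A i)) =
    (\prod_(i <- s) P (X i @^-1` A i))%E.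

Definition independent_systems d (Om : measurableType d) (R : realType)
    (P : probability Om R) (F G : set_system Om) : Prop :=
  forall A B, F A -> G B -> P (A `&` B) = (P A * P B)%E.

(* The sigma-algebra generated by the variables [X t], [t \in D]. *)
Definition sigma_process (Om : Type) (R : realType) d' (E : measurableType d')
    (D : set R) (X : R -> Om -> E) : set_system Om :=
  <<s \bigcup_(t in D) preimage_set_system setT (X t) measurable >>.

Definition brownian_motion d (Om : measurableType d) (R : realType)
    (P : probability Om R) (W : R -> Om -> R) : Prop :=
  [/\ forall t : R, 0 <= t -> measurable_fun setT (W t),
      forall w, W 0 w = 0,
      forall w, {within `[0, +oo[, continuous (W ^~ w)},
      forall s t : R, 0 <= s -> s < t -> forall A : set R, measurable A ->
        P ((fun w => W t w - W s w) @^-1` A) =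
        normal_prob 0 (Num.sqrt (t - s)) A &
      forall (n : nat) (t : nat -> R), 0 <= t 0%N ->
        (forall i, t i <= t i.+1) ->
        mutually_independent P
          (fun (i : 'I_n) w => W (t i.+1) w - W (t i) w)].

Definition renewal_arrivals d (Om : measurableType d) (R : realType)
    (P : probability Om R) (T : nat -> Om -> R) : Prop :=
  [/\ forall k, measurable_fun setT (T k),
      forall w, T 0%N w = 0,
      forall k w, T k w < T k.+1 w,
      mutually_independent P (fun k w => T k.+1 w - T k w) &
      forall k (A : set R), measurable A ->
        P ((fun w => T k.+1 w - T k w) @^-1` A) = P (T 1%N @^-1` A)].

(* The index [k] is unique when it exists; it exists for all [t >= 0] unless
   the arrival times accumulate, which has probability 0 for a renewal process.
   On that null event the value is 0 from the accumulation time on. *)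
Definition renewal_count (Om : Type) (R : realType) (T : nat -> Om -> R)
    (t : R) (w : Om) : nat :=
  xget 0%N [set k | T k w <= t /\ t < T k.+1 w].

Section filtrations.
Context d (Om : measurableType d) (R : realType).
Implicit Type G : R -> set_system Om.

Definition filtration G : Prop :=
  [/\ forall t : R, 0 <= t -> sigma_algebra setT (G t),
      forall t : R, 0 <= t -> G t `<=` measurable &
      forall s t : R, 0 <= s -> s <= t -> G s `<=` G t].

Definition right_continuous_filtration G : Prop :=
  forall t : R, 0 <= t -> G t = \bigcap_(s in [set s | t < s]) G s.

Definition adapted G d' (E : measurableType d') (X : R -> Om -> E) : Prop :=
  forall t : R, 0 <= t -> forall A, measurable A -> G t (X t @^-1` A).

(* The smallest right-continuous filtration to which [W] and [N] are adapted
   (an intersection of right-continuous filtrations is one itself). *)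
Definition smallest_rc_filtration (W : R -> Om -> R) (N : R -> Om -> nat) :
    R -> set_system Om :=
  fun t => \bigcap_(G in [set G | [/\ filtration G,
      right_continuous_filtration G, adapted G W & adapted G N]]) G t.

Definition stopped_sigma_algebra G (tau : Om -> R) : set_system Om :=
  [set A | measurable A /\
    forall t : R, 0 <= t -> G t (A `&` [set w | tau w <= t])].

End filtrations.

Definition step_process (Om : Type) (R : realType) (T : nat -> Om -> R)
    (b : nat -> Om -> R) : R -> Om -> R :=
  fun t w => b (renewal_count T t w) w.

Definition strategy d (Om : measurableType d) (R : realType)
    (W : R -> Om -> R) (T : nat -> Om -> R) (B : R -> Om -> R) : Prop :=
  exists b : nat -> Om -> R,
    [/\ forall k (A : set R), measurable A ->
          stopped_sigma_algebra
            (smallest_rc_filtration W (renewal_count T)) (T k) (b k @^-1` A),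
        forall k w, 0 <= b k w <= 1 &
        forall (t : R) w, 0 <= t -> B t w = step_process T b t w].

Definition drift (R : realType) (eta theta b : R) : R := eta - (1 - b) * theta.

(* The stochastic integral of [sigma(B_s)] is the elementary integral of a
   process that is constant on each interval [T_k, T_{k+1}):
   the sum over k <= N_t of sigma(B_{T_k}) (W_{min(t, T_{k+1})} - W_{T_k}). *)
Definition surplus (Om : Type) (R : realType) (W : R -> Om -> R)
    (T : nat -> Om -> R) (eta theta sigma : R) (B : R -> Om -> R)
    (t : R) (w : Om) : R :=
  \int[lebesgue_measure]_(s in `[0, t[) drift eta theta (B s w) +
  \sum_(0 <= k < (renewal_count T t w).+1)
    sigma * B (T k w) w * (W (Num.min t (T k.+1 w)) w - W (T k w) w).

Definition drawdown (Om : Type) (R : realType) (W : R -> Om -> R)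
    (T : nat -> Om -> R) (eta theta sigma z : R) (B : R -> Om -> R)
    (t : R) (w : Om) : R :=
  let X s := surplus W T eta theta sigma B s w in
  Num.max z (sup [set X s | s in `[0, t]]) - X t.

Definition cost d (Om : measurableType d) (R : realType)
    (P : probability Om R) (W : R -> Om -> R) (T : nat -> Om -> R)
    (eta theta sigma dcrit r : R) (B : R -> Om -> R) (z : R) : \bar R :=
  (\int[P]_w \sum_(0 <= k <oo)
     (if dcrit < drawdown W T eta theta sigma z B (T k w) w
      then expR (- r * T k w) else 0)%:E)%E.

Definition value d (Om : measurableType d) (R : realType)
    (P : probability Om R) (W : R -> Om -> R) (T : nat -> Om -> R)
    (eta theta sigma dcrit r : R) (z : R) : \bar R :=
  ereal_inf [set cost P W T eta theta sigma dcrit r B z | B in strategy W T].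

(* E[e^{-r T_1} v(Delta_z^b(T_1))] for the constant strategy [b]. *)
Definition discounted_value d (Om : measurableType d) (R : realType)
    (P : probability Om R) (W : R -> Om -> R) (T : nat -> Om -> R)
    (eta theta sigma dcrit r : R) (z b : R) : \bar R :=
  (\int[P]_w ((expR (- r * T 1%N w))%:E *
     value P W T eta theta sigma dcrit r
       (drawdown W T eta theta sigma z (fun _ _ => b) (T 1%N w) w)))%E.

(* [feedback_prefix bs z n] gives the retention levels [b_0, ..., b_{n-1}] of
   the feedback strategy; from index [n] on its values are irrelevant, because
   the drawdown at [T_n] depends on [b_0, ..., b_{n-1}] only
   (see [feedback_strategyE]). *)
Fixpoint feedback_prefix (Om : Type) (R : realType) (W : R -> Om -> R)
    (T : nat -> Om -> R) (eta theta sigma : R) (bs : R -> R) (z : R)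
    (n : nat) : nat -> Om -> R :=
  if n is k.+1 then
    let b := feedback_prefix W T eta theta sigma bs z k in
    fun j w => if (j < k)%N then b j w
               else bs (drawdown W T eta theta sigma z (step_process T b)
                          (T k w) w)
  else fun _ _ => 0.

Definition feedback_strategy (Om : Type) (R : realType) (W : R -> Om -> R)
    (T : nat -> Om -> R) (eta theta sigma : R) (bs : R -> R) (z : R) :
    R -> Om -> R :=
  step_process T
    (fun k => feedback_prefix W T eta theta sigma bs z k.+1 k).

Section feedback_equation.
Context (Om : Type) (R : realType) (W : R -> Om -> R) (T : nat -> Om -> R).
Context (eta theta sigma : R).
Context (Tlt : forall k w, T k w < T k.+1 w).

Lemma arrivals_le w j k : (j <= k)%N -> T j w <= T k w.
Proof.
elim: k => [|k IH]; first by rewrite leqn0 => /eqP ->.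
rewrite leq_eqVlt => /orP[/eqP -> //|]; rewrite ltnS => /IH h.
exact: le_trans h (ltW (Tlt _ _)).
Qed.

Lemma renewal_countE w k t :
  T k w <= t -> t < T k.+1 w -> renewal_count T t w = k.
Proof.
move=> h1 h2; rewrite /renewal_count; case: xgetP => [j _ [g1 g2]|/(_ k)]; last first.
  by case.
case: (ltngtP j k) => // jk.
- by have := lt_le_trans g2 (le_trans (arrivals_le w jk) h1); rewrite ltxx.
- by have := lt_le_trans h2 (le_trans (arrivals_le w jk) g1); rewrite ltxx.
Qed.

Lemma renewal_count_arrival w k : renewal_count T (T k w) w = k.
Proof. exact: renewal_countE. Qed.

Lemma renewal_count_lt w k t :
  T 0%N w <= t -> t < T k w -> (renewal_count T t w < k)%N.
Proof.
move=> t0; elim: k => [|k IH tk]; first by rewrite ltNge t0.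
case: (ltP t (T k w)) => [/IH/ltnW //|kt].
by rewrite (renewal_countE kt tk).
Qed.

Lemma eq_surplus w n t (B B' : R -> Om -> R) : T 0%N w = 0 -> t <= T n w ->
  (forall s, 0 <= s -> s < T n w -> B s w = B' s w) ->
  0 <= t ->
  surplus W T eta theta sigma B t w = surplus W T eta theta sigma B' t w.
Proof.
move=> T0 tn BB t0; rewrite /surplus; congr (_ + _).
  apply: eq_Rintegral => s; rewrite inE /= in_itv /= => /andP[s0 st].
  by rewrite BB// (lt_le_trans st).
have T_ge0 k : 0 <= T k w by rewrite -T0 arrivals_le.
move: tn; rewrite le_eqVlt => /orP[/eqP tn|tn].
  rewrite tn renewal_count_arrival !big_nat_recr//=; congr (_ + _).
    by apply: eq_big_nat => k /andP[_ kn]; rewrite BB// (lt_le_trans (Tlt k w))// arrivals_le.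
  by rewrite min_l ?subrr ?mulr0// ltW.
have Nn := renewal_count_lt (etrans (congr1 (<=%R ^~ t) T0) t0) tn.
apply: eq_big_nat => k /andP[_ kN]; rewrite BB//.
by rewrite (lt_le_trans (Tlt k w))// arrivals_le// (leq_trans kN).
Qed.

Lemma eq_drawdown w n z (B B' : R -> Om -> R) : T 0%N w = 0 ->
  (forall s, 0 <= s -> s < T n w -> B s w = B' s w) ->
  drawdown W T eta theta sigma z B (T n w) w =
  drawdown W T eta theta sigma z B' (T n w) w.
Proof.
move=> T0 BB; have T_ge0 : 0 <= T n w by rewrite -T0 arrivals_le.
rewrite /drawdown (eq_surplus T0 (lexx _) BB T_ge0); congr (Num.max _ (sup _) - _).
apply: eq_imagel => s /=; rewrite in_itv /= => /andP[s0 sn].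
exact: eq_surplus T0 sn BB s0.
Qed.

Lemma feedback_prefixE bs z w j n : (j < n)%N ->
  feedback_prefix W T eta theta sigma bs z n j w =
  feedback_prefix W T eta theta sigma bs z j.+1 j w.
Proof.
elim: n => // n IH; rewrite ltnS leq_eqVlt => /orP[/eqP -> //|jn].
by rewrite -(IH jn) /= jn.
Qed.

(* B*_t = b*(Delta_z^{B*}(T_{N_t})) *)
Lemma feedback_strategyE bs z t w : T 0%N w = 0 ->
  feedback_strategy W T eta theta sigma bs z t w =
  bs (drawdown W T eta theta sigma z
        (feedback_strategy W T eta theta sigma bs z)
        (T (renewal_count T t w) w) w).
Proof.
move=> T0; rewrite {1}/feedback_strategy /step_process /= ltnn; congr bs.
apply: eq_drawdown => // s s0 sT.
rewrite /feedback_strategy /step_process -(@feedback_prefixE _ _ _ _ (renewal_count T t w)) //.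
by apply: renewal_count_lt => //; rewrite T0.
Qed.

End feedback_equation.

(* Main.v *)
(* Let G be the sigma-algebra stopped at T_k.  The pair formed by the next
   interarrival time and the path of W after T_k is independent of G and has the
   law of (T_1, W).  The drawdowns at the arrival times are therefore a
   controlled Markov chain, with transition z |-> dd_step z b T_1 W, and the cost
   is the discounted number of visits of this chain to ]d, +oo[.

   The Bellman operator u |-> 1_{z > d} + inf_b E[e^{-r T_1} u(dd_step z b T_1 W)]
   preserves the functions that are nondecreasing with values in
   [0, 1 / (1 - phi)], where phi = E[e^{-r T_1}] < 1, so it has a fixed point u
   among them.  Iterating the fixed-point inequality along the chain, every
   strategy costs at least u, and the feedback strategy of a measurable
   e-optimal selector costs at most u + e / (1 - phi); hence u is the value
   function.  The function b* is then a selector with e = 0. *)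
Require Import Defs.
From HB Require Import structures.
From mathcomp Require Import all_boot all_order all_algebra.
From mathcomp Require Import all_classical all_reals all_analysis measurable_realfun.
From mathcomp Require Import ring.
Import Order.TTheory GRing.Theory Num.Theory.
Import numFieldNormedType.Exports.

Set Implicit Arguments.
Unset Strict Implicit.
Unset Printing Implicit Defensive.
Local Open Scope classical_set_scope.
Local Open Scope ring_scope.

(** * Independence *)

(** The independence stated above splits in two, because each half needs its own enlargement of the
    stopped sigma-algebra. The path of [W] after [T k] is compared with the earlier path together
    with all arrival times; the next interarrival time is compared with the whole path of [W]
    together with [T 0, ..., T k]. The filtration is an intersection, so an upper bound for it comes
    from exhibiting one right-continuous filtration that contains enough. Monotonicity in [z] does
    the work of measurability: a nondecreasing function is Borel, so no infimum over uncountably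
    many [b] or strategies has to be shown measurable in another way. The bound [1 / (1 - phi)] is
    the sum of the [phi ^ k = E[e^{-r T_k}]], the cost of a drawdown that is critical at every
    arrival. The hypothesis on [b*] speaks of the value function and says nothing about the fixed
    point until the two are identified; this is why almost optimal selectors come before it. *)

Section independence.
Context d (Om : measurableType d) (R : realType) (P : probability Om R).
Implicit Types (F G : set_system Om) (A B : set Om).

Lemma setI_closed_setT F : setI_closed F -> setI_closed (F `|` [set setT]).
Proof.
move=> FI A B [FA|->] [FB|->]; rewrite ?setTI ?setIT.
- by left; exact: FI.
- by left.
- by left.
- by right.
Qed.

(** Adjoining [setT] gives the uniqueness theorem for measures its exhausting sequence, the constant
    one. *)
Lemma g_sigma_setT (T : Type) (F : set_system T) :
  <<s F >> = <<s F `|` [set setT] >>.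
Proof.
apply/seteqP; split; first by apply: sub_sigma_algebra2; exact: subsetUl.
apply: smallest_sub; first exact: smallest_sigma_algebra.
move=> A [FA|->]; first exact: sub_sigma_algebra.
have [s0 sC _] := @smallest_sigma_algebra T setT F.
by have := sC _ s0; rewrite setD0.
Qed.

(** For a fixed [B] in [G], the restriction of [P] to [B] and the multiple of [P] by [P B] are
    finite measures of the same mass that agree on the pi-system [F]. *)
Lemma independent_systems_sigmal F G : setI_closed F -> F `<=` measurable ->
  G `<=` measurable -> independent_systems P F G ->
  independent_systems P <<s F >> G.
Proof.
move=> FI Fm Gm FG A B; rewrite g_sigma_setT => FA GB; have mB := Gm _ GB.
have PB0 : 0 <= fine (P B) by exact: fine_ge0.
have PBE : P B = (fine (P B))%:E by rewrite fineK// fin_num_measure.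
rewrite PBE muleC.
have := @g_sigma_algebra_measure_unique _ _ _ (F `|` [set setT]) _
  (fun=> setT) _ _ (mrestr P mB) (mscale (NngNum PB0) P) (setI_closed_setT FI) _ _ _ FA.
rewrite /mrestr /mscale /=; apply.
- by move=> C [/Fm//|->].
- by move=> _; right.
- by rewrite bigcup_const.
- move=> C [FC|->]; rewrite /= /mrestr /mscale /=; last by rewrite setTI probability_setT mule1 PBE.
  by rewrite FG// muleC PBE.
- by move=> k; rewrite /= /mrestr setTI -ge0_fin_numE// fin_num_measure.
Qed.

Lemma independent_systemsC F G : independent_systems P F G ->
  independent_systems P G F.
Proof. by move=> FG A B GA FB; rewrite setIC FG// muleC. Qed.

Lemma independent_systemsS F G F' G' : F' `<=` F -> G' `<=` G ->
  independent_systems P F G -> independent_systems P F' G'.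
Proof. by move=> FF GG FG A B /FF FA /GG; exact: FG. Qed.

Lemma g_sigma_sub_measurable F : F `<=` measurable -> <<s F >> `<=` measurable.
Proof. by apply: smallest_sub; exact: sigma_algebra_measurable. Qed.

Lemma independent_systems_sigma F G : setI_closed F -> setI_closed G ->
  F `<=` measurable -> G `<=` measurable -> independent_systems P F G ->
  independent_systems P <<s F >> <<s G >>.
Proof.
move=> FI GI Fm Gm FG; apply: independent_systemsC.
apply: independent_systems_sigmal => //; first exact: g_sigma_sub_measurable.
by apply: independent_systemsC; exact: independent_systems_sigmal.
Qed.

End independence.

Section freezing.
Context d (Om : measurableType d) (R : realType) (P : probability Om R).
Context d1 (E1 : measurableType d1) d2 (E2 : measurableType d2).

(** The hypothesis on rectangles makes the law of [(X, Y)] the product of the laws of [X] and [Y'],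
    and Tonelli does the rest. [Y'] only lends its law: it is integrated in a separate variable and
    may depend on [X]. *)
Lemma freezing (X : Om -> E1) (Y Y' : Om -> E2) (f : E1 * E2 -> \bar R) :
  measurable_fun setT X -> measurable_fun setT Y -> measurable_fun setT Y' ->
  (forall A B, measurable A -> measurable B ->
    P (X @^-1` A `&` Y @^-1` B) = (P (X @^-1` A) * P (Y' @^-1` B))%E) ->
  measurable_fun [set: (E1 * E2)%type] f -> (forall x, 0 <= f x)%E ->
  (\int[P]_w f (X w, Y w) = \int[P]_w \int[P]_w' f (X w, Y' w'))%E.
Proof.
move=> mX mY mY' XY mf f0.
pose mXY := measurable_fun_pair mX mY.
pose PX := [the probability _ _ of distribution P (mfun_Sub (mem_set mX : X \in mfun))].
pose PY := [the probability _ _ of distribution P (mfun_Sub (mem_set mY' : Y' \in mfun))].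
transitivity (\int[pushforward P (fun w => (X w, Y w))]_z f z)%E.
  by rewrite ge0_integral_pushforward.
transitivity (\int[(PX \x PY)%E]_z f z)%E.
  apply: eq_measure_integral => A mA _; apply/esym.
  apply: product_measure_unique => // B C mB mC.
rewrite fubini_tonelli1// /fubini_F ge0_integral_pushforward//=; last 2 first.
- exact: (measurable_fun_fubini_tonelli_F f mf f0).
- by move=> x _; apply: integral_ge0.
apply: eq_integral => w _ /=; rewrite ge0_integral_pushforward//.
exact: measurable_fun_pair2.
Qed.

End freezing.

Section pi_system_law.
Context d (Om : measurableType d) (R : realType) (P : probability Om R).
Context d1 (E1 : measurableType d1).

(** Uniqueness of measures applied to the law of [X] under [P] restricted to [B]. With [B = setT] it
    says that two variables have the same law. *)
Lemma pi_system_law (G : set_system E1) (B : set Om) (X Y : Om -> E1) :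
  measurable = <<s G >> -> setI_closed G -> measurable B ->
  measurable_fun setT X -> measurable_fun setT Y ->
  (forall C, G C -> P (B `&` X @^-1` C) = (P B * P (Y @^-1` C))%E) ->
  forall C, measurable C -> P (B `&` X @^-1` C) = (P B * P (Y @^-1` C))%E.
Proof.
move=> mG GI mB mX mY GXY C mC.
have PB0 : 0 <= fine (P B) by exact: fine_ge0.
have PBE : P B = (fine (P B))%:E by rewrite fineK// fin_num_measure.
pose PY : probability E1 R := distribution P (mfun_Sub (mem_set mY : Y \in mfun)).
have mXm : measurable_fun setT (X : Om -> E1) := mX.
pose PX : {measure set E1 -> \bar R} := 
  measure_function_pushforward__canonical__measure_function_Measure (mrestr P mB) mXm.
have := @g_sigma_algebra_measure_unique _ _ _ (G `|` [set setT]) _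
  (fun=> setT) _ _ PX (mscale (NngNum PB0) PY) (setI_closed_setT GI) _ _ C.
rewrite -g_sigma_setT -mG /PX /mscale /= /mrestr /pushforward/= => h.
rewrite setIC; transitivity (mscale (NngNum PB0) PY C); last first.
  by rewrite /mscale /= -PBE.
apply: h => //.
- by move=> A [GA|->//]; rewrite mG; exact: sub_sigma_algebra.
- by move=> _; right.
- by rewrite bigcup_const.
- move=> A [GA|->]; first by rewrite setIC GXY// /mscale /= -PBE.
  by rewrite preimage_setT setTI /mscale /= -PBE probability_setT mule1.
- by move=> _; rewrite preimage_setT setTI -ge0_fin_numE// fin_num_measure.
Qed.

End pi_system_law.

(** * Cylinders and families of independent variables *)

Section cylinders.
Context (T : Type) d' (E : measurableType d') (I : eqType).
Implicit Types (X : I -> T -> E) (J : set I).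

Definition sigma_gen J X : set_system T :=
  \bigcup_(i in J) preimage_set_system setT (X i) measurable.

(** The pi-system behind [sigma_gen], which itself is not closed under intersection. *)
Definition cylinder J X : set_system T :=
  [set B | exists (s : seq I) (A : I -> set E),
    [/\ uniq s, forall i, i \in s -> J i, forall i, measurable (A i) &
        B = \bigcap_(i in [set` s]) (X i @^-1` A i)]].

Lemma cylinder_setI_closed J X : setI_closed (cylinder J X).
Proof.
move=> _ _ [s1 [A1 [u1 J1 m1 ->]]] [s2 [A2 [u2 J2 m2 ->]]].
exists (undup (s1 ++ s2)), (fun i => (if i \in s1 then A1 i else setT) `&`
  (if i \in s2 then A2 i else setT)); split.
- exact: undup_uniq.
- by move=> i; rewrite mem_undup mem_cat => /orP[/J1|/J2].
- by move=> i; apply: measurableI; case: ifP.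
- apply/seteqP; split=> [x [h1 h2] i _ /=|x h]; first split.
  + by case: ifPn => // /h1.
  + by case: ifPn => // /h2.
  + split=> i /= hi; have /= := h i; rewrite mem_undup mem_cat hi ?orbT => /(_ isT).
    * by case.
    * by case.
Qed.

Lemma cylinderT J X : cylinder J X setT.
Proof. by exists [::], (fun=> setT); split => //; apply/seteqP; split. Qed.

Lemma cylinder1 J X i A : J i -> measurable A -> cylinder J X (X i @^-1` A).
Proof.
move=> Ji mA; exists [:: i], (fun=> A); split => //.
- by move=> j; rewrite inE => /eqP ->.
- apply/seteqP; split => [x xA j /=|x /(_ i)]; first by rewrite inE => /eqP ->.
  by apply; rewrite /= inE.
Qed.

Lemma cylinder_sigma_gen J X : cylinder J X `<=` <<s sigma_gen J X >>.
Proof.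
move=> _ [s [A [us Js mA ->]]].
elim: s us Js => [|i s IH] /= us Js.
  rewrite (_ : \bigcap_(i in _) _ = setT); last by apply/seteqP; split.
  have [s0 sC _] := @smallest_sigma_algebra T setT (sigma_gen J X).
  by have := sC _ s0; rewrite setD0.
have {IH}h1 : <<s sigma_gen J X >> (\bigcap_(i in [set` s]) X i @^-1` A i).
  apply: IH; first by case/andP: us.
  by move=> j js; apply: Js; rewrite inE js orbT.
have h2 : <<s sigma_gen J X >> (X i @^-1` A i).
  apply: sub_sigma_algebra; exists i; first by apply: Js; rewrite mem_head.
  by exists (A i) => //; rewrite setTI.
rewrite (_ : \bigcap_(i in _) _ =
    (X i @^-1` A i) `&` \bigcap_(i in [set` s]) X i @^-1` A i); last first.
  apply/seteqP; split => [x h|x [h1' h2'] j /=].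
    split; first by apply: h; rewrite /= mem_head.
    by move=> j /= js; apply: h; rewrite /= inE js orbT.
  by rewrite inE => /orP[/eqP -> //|/h2'].
have [s0 sC sU] := @smallest_sigma_algebra T setT (sigma_gen J X).
rewrite -[X in _ X]setCK setCI -!setTD; apply: (sC).
rewrite -bigcup2E; apply: sU => -[|[|k]] //=; exact: sC.
Qed.

Lemma g_sigma_cylinder J X : <<s cylinder J X >> = <<s sigma_gen J X >>.
Proof.
apply/seteqP; split.
  apply: smallest_sub; first exact: smallest_sigma_algebra.
  exact: cylinder_sigma_gen.
apply: sub_sigma_algebra2 => _ [i Ji [A mA <-]]; rewrite setTI.
exact: cylinder1.
Qed.

End cylinders.

Section grouping.
Context d (Om : measurableType d) (R : realType) (P : probability Om R).
Context (I : eqType) (X : I -> Om -> R).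
Hypothesis mX : forall i, measurable_fun setT (X i).

Lemma sigma_gen_measurable J : sigma_gen J X `<=` measurable.
Proof. by move=> _ [i _ [A mA <-]]; exact: mX. Qed.

Lemma cylinder_measurable J : cylinder J X `<=` measurable.
Proof.
move=> A /cylinder_sigma_gen; apply: g_sigma_sub_measurable.
exact: sigma_gen_measurable.
Qed.

(** A cylinder over [J1] and one over [J2] have disjoint index lists, so their intersection is again
    one cylinder, over the concatenated list, and the product formula splits. *)
Lemma mutually_independent_grouping (J1 J2 : set I) :
  mutually_independent P X -> (forall i, J1 i -> J2 i -> False) ->
  independent_systems P <<s sigma_gen J1 X >> <<s sigma_gen J2 X >>.
Proof.
move=> iX J12; rewrite -!g_sigma_cylinder; apply: independent_systems_sigma.
- exact: cylinder_setI_closed.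
- exact: cylinder_setI_closed.
- exact: cylinder_measurable.
- exact: cylinder_measurable.
move=> _ _ [s1 [A1 [u1 J1s m1 ->]]] [s2 [A2 [u2 J2s m2 ->]]].
have d12 i : i \in s2 -> (i \in s1) = false.
  by move=> i2; apply/negP => i1; exact: J12 (J1s _ i1) (J2s _ i2).
rewrite iX// iX//.
pose A i := if i \in s1 then A1 i else A2 i.
rewrite (_ : _ `&` _ = \bigcap_(i in [set` s1 ++ s2]) (X i @^-1` A i)); last first.
  apply/seteqP; split => [x [h1 h2] i /=|x h].
    rewrite mem_cat /A => /orP[i1|i2]; first by rewrite i1; exact: h1.
    by rewrite d12//; exact: h2.
  split=> i /= hi; have /= := h i; rewrite mem_cat hi ?orbT => /(_ isT).
    by rewrite /A hi.
  by rewrite /A d12.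
rewrite iX; last 2 first.
- rewrite cat_uniq u1 u2 andbT; apply/hasPn => i /= i2.
  by rewrite (d12 _ i2).
- by move=> i; rewrite /A; case: ifP.
rewrite big_cat/=; congr (_ * _)%E; rewrite !big_seq; apply: eq_bigr => i hi.
  by rewrite /A hi.
by rewrite /A d12.
Qed.

End grouping.

(** Brings finitely many times into the form required by the independence of Brownian increments, an
    infinite nondecreasing sequence, started at [0] so that values of [W] are sums of increments. *)
Lemma sorted_grid (R : realDomainType) (S : seq R) :
  (forall v, v \in S -> 0 <= v) ->
  exists (t : nat -> R) (n : nat), [/\ t 0%N = 0, forall i, t i <= t i.+1 &
    forall v, v \in S -> exists2 i, (i <= n)%N & t i = v].
Proof.
move=> S0; set L := sort <=%O (0 :: S).
have sL : sorted <=%O L by exact: sort_le_sorted.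
have memL v : (v \in L) = (v \in 0 :: S) by rewrite mem_sort.
have L_gt0 : (0 < size L)%N by rewrite size_sort.
(* Past the end of the sorted list the grid stays at its last point. *)
pose c i := minn i (size L).-1.
have cL i : (c i < size L)%N.
  by rewrite /c (leq_ltn_trans (geq_minr _ _))// prednK.
have le_nth i j : (i <= j)%N -> (j < size L)%N -> nth 0 L i <= nth 0 L j.
  move=> ij jL; apply: (sorted_leq_nth le_trans le_refl 0 sL) => //.
  by rewrite inE (leq_ltn_trans ij).
exists (fun i => nth 0 L (c i)), (size L); split.
- rewrite /c min0n; apply/eqP; rewrite eq_le; apply/andP; split.
    have L0 : 0 \in L by rewrite memL mem_head.
    by rewrite -[leRHS](nth_index 0 L0) le_nth// index_mem.
  have := mem_nth 0 L_gt0; rewrite memL inE => /orP[/eqP -> //|]; exact: S0.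
- move=> i; apply: le_nth => //; rewrite /c leq_min geq_minr andbT.
  by rewrite (leq_trans (geq_minl _ _)).
- move=> v vS; have vL : v \in L by rewrite memL inE vS orbT.
  exists (index v L); first by rewrite ltnW// index_mem.
  have := vL; rewrite -index_mem => h; rewrite /c (minn_idPl _) ?nth_index//.
  by rewrite -ltnS prednK.
Qed.

Section same_law.
Context d (Om : measurableType d) (R : realType) (P : probability Om R).
Context (I : eqType) (X X' : I -> Om -> R).
Hypotheses (mX : forall i, measurable_fun setT (X i))
  (mX' : forall i, measurable_fun setT (X' i)).

Let proj (i : I) (x : I -> R) : R := x i.
Let E : measurableType _ := g_sigma_algebraType (sigma_gen setT proj).

Lemma proj_measurable i : measurable_fun setT (proj i : E -> R).
Proof.
move=> _ A mA; rewrite setTI; apply: sub_sigma_algebra; exists i => //.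
by exists A => //; rewrite setTI.
Qed.

Lemma measurable_funext (Y : I -> Om -> R) : (forall i, measurable_fun setT (Y i)) ->
  measurable_fun setT ((fun w i => Y i w) : Om -> E).
Proof.
move=> mY; apply: (@measurability _ _ _ E setT _ (sigma_gen setT proj)); first by [].
move=> _ [_ [i _ [A mA <-]] <-]; rewrite !setTI.
by have := mY i measurableT A mA; rewrite setTI.
Qed.

(** For independent families the probability of a cylinder is a product of marginal probabilities,
    so the marginals determine the joint law. *)
Lemma independent_same_law (C : set E) :
  mutually_independent P X -> mutually_independent P X' ->
  (forall i A, measurable A -> P (X i @^-1` A) = P (X' i @^-1` A)) ->
  measurable C -> P ((fun w i => X i w) @^-1` C) = P ((fun w i => X' i w) @^-1` C).
Proof.
move=> iX iX' XX' mC.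
have mXf := measurable_funext mX; have mXf' := measurable_funext mX'.
have := @pi_system_law _ _ _ P _ E (cylinder setT proj) setT _ _ _ _ _ mXf mXf' _ C mC.
rewrite !setTI probability_setT !mul1e; apply => //.
- by rewrite g_sigma_cylinder.
- exact: cylinder_setI_closed.
- move=> _ [s [A [us _ mA ->]]]; rewrite setTI mul1e !preimage_bigcap iX// iX'//.
  by apply: eq_bigr => i _; exact: XX'.
Qed.

End same_law.

(** Only differences are assumed measurable: in the sigma-algebra generated by increments the [Z k]
    themselves need not be. *)
Lemma measurable_telescope d (T : measurableType d) (R : realType)
    (Z : nat -> T -> R) i j : (i <= j)%N ->
  (forall k, (i <= k < j)%N -> measurable_fun setT (fun w => Z k.+1 w - Z k w)) ->
  measurable_fun setT (fun w => Z j w - Z i w).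
Proof.
elim: j => [|j IH].
  rewrite leqn0 => /eqP -> _; rewrite (_ : (fun w => _) = cst 0) //.
  by apply/funext => w; rewrite subrr.
rewrite leq_eqVlt => /orP[/eqP -> _|].
  by rewrite (_ : (fun w => _) = cst 0) //; apply/funext => w; rewrite subrr.
rewrite ltnS => ij mZ.
rewrite (_ : (fun w => _) =
    ((fun w => Z j.+1 w - Z j w) \+ (fun w => Z j w - Z i w))); last first.
  by apply/funext => w /=; rewrite subrKA.
apply: measurable_funD; first by apply: mZ; rewrite ij leqnn.
by apply: IH => // k /andP[ik kj]; apply: mZ; rewrite ik ltnW.
Qed.

(** * Increments of Brownian motion *)

Section brownian.
Context d (Om : measurableType d) (R : realType) (P : probability Om R).
Context (W : R -> Om -> R) (W_brownian : brownian_motion P W).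

Let mW t : 0 <= t -> measurable_fun setT (W t).
Proof. by case: W_brownian => + _ _ _ _; exact. Qed.

Lemma measurable_increment s t : 0 <= s -> 0 <= t ->
  measurable_fun setT (fun w => W t w - W s w).
Proof. by move=> s0 t0; apply: measurable_funB; exact: mW. Qed.

Lemma nondecreasing_grid_ge0 (t : nat -> R) i : 0 <= t 0%N ->
  (forall i, t i <= t i.+1) -> 0 <= t i.
Proof. by move=> t0 tS; elim: i => // i ih; exact: le_trans ih (tS i). Qed.

Let incr (t : nat -> R) n (i : 'I_n) (w : Om) := W (t i.+1) w - W (t i) w.

Lemma measurable_grid_increment (t : nat -> R) n (J : set 'I_n) i j (A : set R) :
  (i <= j <= n)%N -> measurable A -> (forall k : 'I_n, (i <= k < j)%N -> J k) ->
  <<s sigma_gen J (@incr t n) >> [set w | A (W (t j) w - W (t i) w)].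
Proof.
move=> /andP[ij jn] mA Jij.
pose T := g_sigma_algebraType (sigma_gen J (@incr t n)).
have : measurable_fun setT ((fun w => W (t j) w - W (t i) w) : T -> R).
  apply: (@measurable_telescope _ _ _ (fun k (w : T) => W (t k) w)) => // k /andP[ik kj].
  move=> _ B mB; rewrite setTI.
  have kn : (k < n)%N by exact: leq_trans kj jn.
  apply: sub_sigma_algebra; exists (Ordinal kn); first by apply: Jij; rewrite /= ik.
  by exists B => //; rewrite setTI.
by move=> /(_ measurableT A mA); rewrite setTI.
Qed.

Definition later s v w := W (s + v) w - W s w.

(** The times of both cylinders are put, together with [s], on one grid. Increments before the grid
    index of [s] produce the past, those after it the future, and the two blocks of increments are
    independent. *)
Lemma brownian_past_future s : 0 <= s ->
  independent_systems P <<s sigma_gen `[0, s] W >>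
                        <<s sigma_gen `[0, +oo[ (later s) >>.
Proof.
move=> s0; rewrite -!g_sigma_cylinder; apply: independent_systems_sigma.
- exact: cylinder_setI_closed.
- exact: cylinder_setI_closed.
- move=> _ [S [A [_ S0 mA ->]]]; rewrite bigcap_seq.
  rewrite big_seq; apply: bigsetI_measurable => v vS; rewrite -[X in measurable X]setTI.
  by apply: mW => //; have /= := S0 _ vS; rewrite in_itv/= => /andP[].
- move=> _ [S [A [_ S0 mA ->]]]; rewrite bigcap_seq.
  rewrite big_seq; apply: bigsetI_measurable => v vS; rewrite -[X in measurable X]setTI.
  have /= := S0 _ vS; rewrite in_itv/= andbT => v0.
  by apply: measurable_increment => //; rewrite addr_ge0.
move=> B C [S1 [A1 [_ S1s mA1 ->]]] [S2 [A2 [_ S2s mA2 ->]]].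
have S1s' v : v \in S1 -> 0 <= v <= s by move=> /S1s; rewrite /= in_itv.
have S2s' v : v \in S2 -> 0 <= v by move=> /S2s; rewrite /= in_itv/= andbT.
have [v|t [n [t0 tS tn]]] := @sorted_grid R (s :: S1 ++ [seq s + v | v <- S2]).
  rewrite inE mem_cat => /or3P[/eqP -> //|/S1s'/andP[]//|/mapP[u /S2s' u0 ->]].
  by rewrite addr_ge0.
have t_ge0 i : 0 <= t i by apply: nondecreasing_grid_ge0; rewrite ?t0.
have le_t i j : (i <= j)%N -> t i <= t j.
  by move=> ij; rewrite -(subnK ij) addnC; elim: (j - i)%N => [|k ih];
    rewrite ?addn0// addnS (le_trans ih).
have [m mn tm] := tn s (mem_head _ _).
have [_ W0 _ _ iW] := W_brownian.
have iincr : mutually_independent P (@incr t n) by apply: iW => //; rewrite t0.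
have mincr i : measurable_fun setT (@incr t n i) by exact: measurable_increment.
have := @mutually_independent_grouping _ _ _ P _ _ mincr
  [set k : 'I_n | (k < m)%N] [set k : 'I_n | (m <= k)%N] iincr.
apply.
- by move=> i /= im; rewrite leqNgt im.
- rewrite bigcap_seq big_seq.
  apply: (@bigsetI_measurable _ (g_sigma_algebraType _)) => v vS.
  have [i ni tiv] : exists2 i, (i <= m)%N & t i = v.
    have [|i ni ti] := tn v; first by rewrite inE mem_cat vS orbT.
    have [im|mi] := leqP i m; first by exists i.
    (* The grid may repeat a time. An index beyond [m] with time at most [s] must carry the time [s]
       itself, and [m] can replace it. *)
    exists m => //; apply/eqP; rewrite eq_le; apply/andP; split.
      by rewrite -ti le_t// ltnW.
    by rewrite tm; have /andP[] := S1s' _ vS.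
  rewrite /measurable/= (_ : _ @^-1` _ = [set w | A1 v (W (t i) w - W (t 0%N) w)]); last first.
    by rewrite t0 tiv; apply/seteqP; split => w /=; rewrite W0 subr0.
  apply: measurable_grid_increment => //; first by rewrite (leq_trans ni).
  by move=> k /andP[_ ki]; exact: leq_trans ki ni.
- rewrite bigcap_seq big_seq.
  apply: (@bigsetI_measurable _ (g_sigma_algebraType _)) => v vS.
  have [i ni tiv] : exists2 i, (m <= i <= n)%N & t i = s + v.
    have [|i ni ti] := tn (s + v); first by rewrite inE mem_cat map_f ?orbT.
    have [mi|im] := leqP m i; first by exists i => //; rewrite mi.
    exists m; rewrite ?leqnn//; apply/eqP; rewrite eq_le; apply/andP; split.
      by rewrite tm lerDl S2s'.
    by rewrite -ti le_t// ltnW.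
  rewrite /measurable/= (_ : _ @^-1` _ = [set w | A2 v (W (t i) w - W (t m) w)]); last first.
    by rewrite tm tiv.
  apply: measurable_grid_increment => //.
  by move=> k /andP[].
Qed.

(** The point is that [g] does not depend on [f]: the same function rebuilds [W] and the shifted [W]
    from their increments. *)
Lemma telescope_grid n j : (j <= n)%N -> exists g : ('I_n -> R) -> R,
  measurable_fun setT (g : g_sigma_algebraType
    (sigma_gen setT (fun (i : 'I_n) (x : 'I_n -> R) => x i)) -> R) /\
  forall f : nat -> R, f j - f 0%N = g (fun k : 'I_n => f k.+1 - f k).
Proof.
elim: j => [_|j IH jn].
  by exists (fun=> 0); split => [|f]; [exact: measurable_cst|rewrite subrr].
have [g [mg gE]] := IH (ltnW jn).
exists (fun x => x (Ordinal jn) + g x); split.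
  apply: measurable_funD => //.
  exact: (@proj_measurable R 'I_n (Ordinal jn)).
by move=> f; rewrite -gE/= subrKA.
Qed.

(** On the times of [C], both processes are the same functions of their increments along a grid, and
    shifting the grid by [s] changes neither the independence nor the variances of the
    increments. *)
Lemma brownian_shift_law s C : 0 <= s -> cylinder `[0, +oo[ (fun v (x : R -> R) => x v) C ->
  P ((fun w v => later s v w) @^-1` C) = P ((fun w v => W v w) @^-1` C).
Proof.
move=> s0 [S [A [uS S0 mA CE]]].
have S0' v : v \in S -> 0 <= v by move=> /S0; rewrite /= in_itv/= andbT.
have [t [n [t0 tS tn]]] := sorted_grid S0'.
have t_ge0 i : 0 <= t i by apply: nondecreasing_grid_ge0; rewrite ?t0.
have [_ W0 _ Wn iW] := W_brownian.
pose X := @incr (fun i => s + t i) n; pose X' := @incr t n.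
pose g j : ('I_n -> R) -> R := 
  if pselect (j <= n)%N is left jn then projT1 (cid (telescope_grid jn)) else cst 0.
have gE j f : (j <= n)%N -> f j - f 0%N = g j (fun k : 'I_n => f k.+1 - f k).
  by move=> jn; rewrite /g; case: pselect => // {}jn; case: cid => /= h [].
pose E : measurableType _ := g_sigma_algebraType
    (sigma_gen setT (fun (i : 'I_n) (x : 'I_n -> R) => x i)).
have mg j : measurable_fun setT (g j : E -> R).
  by rewrite /g; case: pselect => // jn; case: cid => /= h [].
pose i_ v : nat := if pselect (exists2 i, (i <= n)%N & t i = v) is left e
  then projT1 (cid2 e) else 0%N.
have iP v : v \in S -> (i_ v <= n)%N /\ t (i_ v) = v.
  by move=> vS; rewrite /i_; case: pselect => [e|[]]; [case: cid2|exact: tn].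
pose D : set E := \bigcap_(v in [set` S]) (g (i_ v) @^-1` A v).
have mD : measurable D.
  rewrite /D bigcap_seq; apply: bigsetI_measurable => v _.
  by rewrite -[X in measurable X]setTI; exact: mg.
have shiftE v w : v \in S -> later s v w = g (i_ v) (fun k : 'I_n => X k w).
  move=> vS; have [iv tv] := iP v vS.
  by rewrite -(gE _ (fun j => W (s + t j) w))// t0 addr0 tv.
have WE v w : v \in S -> W v w = g (i_ v) (fun k : 'I_n => X' k w).
  move=> vS; have [iv tv] := iP v vS.
  by rewrite -(gE _ (fun j => W (t j) w))// t0 tv W0 subr0.
have preE (Z : R -> Om -> R) (Y : 'I_n -> Om -> R) :
    (forall v w, v \in S -> Z v w = g (i_ v) (Y^~ w)) ->
    (fun w v => Z v w) @^-1` C = (fun w i => Y i w) @^-1` D.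
  move=> ZY; rewrite CE; apply/seteqP; split => w /= h v vS; have /= := h v vS.
    by rewrite ZY.
  by rewrite -ZY.
rewrite (preE _ _ shiftE) (preE _ _ WE).
apply: (independent_same_law _ _ _ _ _ mD).
- by move=> i; apply: measurable_increment; rewrite addr_ge0.
- by move=> i; exact: measurable_increment.
- apply: (iW n (fun i => s + t i)); first by rewrite addr_ge0.
  by move=> i; rewrite lerD2l.
- by apply: iW; rewrite ?t0.
(* Grid steps of length zero are treated apart, since the normal law is postulated only for
   [s < t]. *)
- move=> i B mB; have := tS i; rewrite le_eqVlt => /orP[/eqP tE|tlt].
    rewrite (_ : X i = X' i)//; apply/funext => w.
    by rewrite /X /X' /incr -tE !subrr.
  have stlt : s + t i < s + t i.+1 by rewrite ltrD2l.
  have st0 : 0 <= s + t i by rewrite addr_ge0.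
  have -> := Wn _ _ st0 stlt B mB.
  have -> := Wn _ _ (t_ge0 i) tlt B mB.
  by rewrite opprD addrACA subrr add0r.
Qed.

End brownian.

(** * Path space and the drawdown between two arrivals *)

(** Paths are continuous by type: on the space of all functions, with the sigma-algebra of
    evaluations, neither evaluation at a random time nor a running supremum would be measurable. *)
Definition cpath (R : realType) := continuousType R R.
HB.instance Definition _ (R : realType) := Choice.on (cpath R).
HB.instance Definition _ (R : realType) :=
  isPointed.Build (cpath R) [the continuousType R R of cst 0].

Definition path_at (R : realType) (v : R) (x : cpath R) : R := x v.

Definition path_space (R : realType) : measurableType _ :=
  g_sigma_algebraType (sigma_gen setT (@path_at R)).

Section path_space.
Context (R : realType).

Lemma measurable_path_at v : measurable_fun setT (@path_at R v : path_space R -> R).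
Proof.
move=> _ A mA; rewrite setTI; apply: sub_sigma_algebra; exists v => //.
by exists A => //; rewrite setTI.
Qed.

Lemma measurable_path d (T : measurableType d) (X : T -> path_space R) :
  (forall v, measurable_fun setT (fun w => X w v)) -> measurable_fun setT X.
Proof.
move=> mX; apply: (@measurability _ _ _ (path_space R) setT _ (sigma_gen setT (@path_at R))).
  by [].
move=> _ [_ [v _ [A mA <-]] <-]; rewrite !setTI.
by have := mX v measurableT A mA; rewrite setTI.
Qed.

Lemma floor_approx_cvg (x : R) :
  (Num.floor (n.+1%:R * x))%:~R / n.+1%:R @[n --> \oo] --> x.
Proof.
apply: (@squeeze_cvgr _ _ _ _ (fun n => x - harmonic n) (cst x)).
- apply: nearW => n; apply/andP; split.
    rewrite /harmonic ler_pdivlMr ?ltr0n// mulrBl mulVf ?pnatr_eq0//.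
    rewrite mulrC lerBlDr; have := @floorD1_gt R (n.+1%:R * x).
    by rewrite intrD => /ltW.
  by rewrite /= ler_pdivrMr ?ltr0n// [x * _]mulrC floor_le.
- rewrite -[X in _ --> X]subr0; apply: cvgB; first exact: cvg_cst.
  exact: cvg_harmonic.
- exact: cvg_cst.
Qed.

(** Rounding [t] down to a multiple of [1 / (n + 1)] leaves countably many evaluation times, and
    continuity of the path gives the limit. *)
Lemma measurable_path_eval d (T : measurableType d) (t : T -> R) (X : T -> path_space R) :
  measurable_fun setT t -> measurable_fun setT X ->
  measurable_fun setT (fun w => X w (t w)).
Proof.
move=> mt mX.
pose h n w := X w ((Num.floor (n.+1%:R * t w))%:~R / n.+1%:R).
apply: (@measurable_fun_cvg _ _ _ _ h); last first.
  move=> w _; have Xc : continuous (X w) by exact: cts_fun.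
  apply: (@cvg_comp _ _ _ _ (X w) _ (nbhs (t w))); last exact: Xc.
  exact: floor_approx_cvg.
move=> n _ A mA; rewrite setTI.
rewrite (_ : _ @^-1` A = \bigcup_(i : int) ([set w | Num.floor (n.+1%:R * t w) = i] `&`
    X @^-1` (path_at (i%:~R / n.+1%:R) @^-1` A))); last first.
  apply/seteqP; split => [w hA|w [i _ [/= <- //]]].
  by exists (Num.floor (n.+1%:R * t w)).
apply: countable_bigcupT_measurable => // i; apply: measurableI; last first.
  rewrite -[X in measurable X]setTI; apply: mX => //.
  by rewrite -[X in measurable X]setTI; exact: measurable_path_at.
rewrite (_ : [set w | _] = (fun w => n.+1%:R * t w) @^-1` `[i%:~R, (i + 1)%:~R[); last first.
  apply/seteqP; split => w /=; rewrite in_itv/=.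
    by move=> <-; rewrite floor_le floorD1_gt.
  by move=> tE; exact: floor_def.
rewrite -[X in measurable X]setTI; apply: measurable_funM => //.
Qed.

End path_space.

(** * The drawdown over one interval under a constant strategy *)

Section ddstep.
Context (R : realType) (eta theta sigma : R).

Definition dd_surplus (b : R) (x : R -> R) (s : R) : R :=
  drift eta theta b * s + sigma * b * x s.

Definition dd_step (z b t : R) (x : R -> R) : R :=
  Num.max z (sup [set dd_surplus b x s | s in `[0, t]]) - dd_surplus b x t.

Lemma continuous_dd_surplus b (x : R -> R) : continuous x -> continuous (dd_surplus b x).
Proof.
move=> cx s; apply: cvgD; first by apply: cvgMr; exact: cvg_id.
by apply: cvgMr; exact: cx.
Qed.

Lemma dd_surplus_has_sup b (x : R -> R) t : continuous x -> 0 <= t ->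
  has_sup [set dd_surplus b x s | s in `[0, t]].
Proof.
move=> cx t0; split; first by exists (dd_surplus b x 0), 0 => //=; rewrite in_itv/= lexx.
have [||c _ cmax] := @EVT_max R (dd_surplus b x) 0 t => //.
  exact/continuous_subspaceT/continuous_dd_surplus.
exists (dd_surplus b x c) => _ [s st <-]; exact: cmax.
Qed.

Lemma dd_step_ge0 z b t (x : R -> R) : continuous x -> 0 <= t -> 0 <= dd_step z b t x.
Proof.
move=> cx t0; rewrite /dd_step subr_ge0 le_max; apply/orP; right.
apply: ub_le_sup; first by case: (dd_surplus_has_sup b cx t0).
by exists t => //=; rewrite in_itv/= t0 lexx.
Qed.

Lemma le_dd_step z z' b t (x : R -> R) : z <= z' -> dd_step z b t x <= dd_step z' b t x.
Proof.
move=> zz'; rewrite /dd_step lerD2r ge_max !le_max zz' lexx /=.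
by rewrite orbT.
Qed.

Lemma eq_dd_step z b t (x y : R -> R) : 0 <= t -> (forall s, 0 <= s <= t -> x s = y s) ->
  dd_step z b t x = dd_step z b t y.
Proof.
move=> t0 xy; have xyS s : 0 <= s <= t -> dd_surplus b x s = dd_surplus b y s.
  by move=> st; rewrite /dd_surplus xy.
rewrite /dd_step xyS ?t0 ?lexx//; congr (Num.max _ (sup _) - _).
by apply: eq_imagel => s /=; rewrite in_itv/= => /xyS.
Qed.

Lemma measurable_dd_step d (T : measurableType d) (z b t : T -> R) (X : T -> path_space R) :
  measurable_fun setT z -> measurable_fun setT b -> measurable_fun setT t ->
  measurable_fun setT X -> (forall w, 0 <= t w) ->
  measurable_fun setT (fun w => dd_step (z w) (b w) (t w) (X w)).
Proof.
move=> mz mb mt mX t0.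
have mY (s : T -> R) : measurable_fun setT s ->
    measurable_fun setT (fun w => dd_surplus (b w) (X w) (s w)).
  move=> ms; rewrite /dd_surplus /drift; apply: measurable_funD.
    apply: measurable_funM => //; apply: measurable_funB => //.
    by apply: measurable_funM => //; exact: measurable_funB.
  by apply: measurable_funM; [exact: measurable_funM|exact: measurable_path_eval].
apply: measurable_funB; last exact: mY.
apply: measurable_maxr => //.
apply: (measurability _ (RGenOInfty.measurableE R)) => //.
move=> _ [_ [c ->] <-]; rewrite setTI.
(* The supremum runs over [[0, t w]], which varies with [w]. Clipping the rationals into this
   interval gives a countable index set independent of [w]; by continuity it suffices to detect
   values above [c]. *)
pose clip (s u : R) := Num.max 0 (Num.min s u).
rewrite (_ : _ @^-1` _ = \bigcup_(q : rat)
    (fun w => dd_surplus (b w) (X w) (clip (ratr q) (t w))) @^-1` `]c, +oo[); last first.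
  apply/seteqP; split => [w /=|w [q _] /=]; rewrite in_itv/= andbT.
    move=> csup; have cX : continuous (X w) by exact: cts_fun.
    have [ne _] := dd_surplus_has_sup (b w) cX (t0 w).
    have [_ [s st <-] cs] := sup_gt ne csup.
    have clips : clip s (t w) = s.
      move: st; rewrite /= in_itv/= => /andP[s0 st].
      by rewrite /clip min_l// max_r.
    pose f u := dd_surplus (b w) (X w) (clip u (t w)).
    have cf : continuous f.
      move=> u; apply: (@continuous_comp _ _ _ (fun u => clip u (t w))); last first.
        by have := @continuous_dd_surplus (b w) _ cX; exact.
      apply: continuous_max; first exact: cvg_cst.
      by apply: continuous_min; [exact: cvg_id|exact: cvg_cst].
    have oU : open (f @^-1` `]c, +oo[).
      by apply: open_comp; [move=> u _; exact: cf|exact: interval_open].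
    have [|x [fu [q _ qu]]] := @dense_rat R _ _ oU.
      by exists s; rewrite /f /= in_itv/= andbT clips.
    by exists q => //; rewrite /= qu.
  move=> cq; have cX : continuous (X w) by exact: cts_fun.
  have [_ hub] := dd_surplus_has_sup (b w) cX (t0 w).
  rewrite in_itv/= andbT; apply: lt_le_trans cq _; apply: ub_le_sup => //.
  exists (clip (ratr q) (t w)) => //=; rewrite in_itv/= /clip le_max lexx /=.
  by rewrite ge_max t0 ge_min lexx orbT.
apply: bigcupT_measurable_rat => q; rewrite -[X in measurable X]setTI.
apply: mY => //; apply: measurable_maxr => //; exact: measurable_minr.
Qed.

End ddstep.

Lemma supU (R : realType) (A B : set R) : has_sup A -> has_sup B ->
  sup (A `|` B) = Num.max (sup A) (sup B).
Proof.
move=> [[a Aa] uA] [[b Bb] uB]; apply/eqP; rewrite eq_le; apply/andP; split.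
  apply: ge_sup; first by exists a; left.
  move=> x [Ax|Bx]; rewrite le_max; apply/orP; [left|right]; exact: ub_le_sup.
have uAB : has_ubound (A `|` B).
  case: uA uB => [M hM] [N hN]; exists (Num.max M N) => x [/hM|/hN] h.
    by rewrite le_max h.
  by rewrite le_max h orbT.
rewrite ge_max; apply/andP; split; apply: ge_sup.
- by exists a.
- by move=> x Ax; apply: ub_le_sup => //; left.
- by exists b.
- by move=> x Bx; apply: ub_le_sup => //; right.
Qed.

Lemma sup_addl (R : realType) (c : R) (A : set R) : has_sup A ->
  sup [set c + x | x in A] = c + sup A.
Proof.
move=> hA; have hc : has_sup [set c] by split; exists c => // _ ->.
rewrite -{2}(sup1 c) -sup_sumE//; congr sup; apply/seteqP; split.
  by move=> _ [x Ax <-]; exists c => //; exists x.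
by move=> _ [_ -> [x Ax <-]]; exists x.
Qed.

(** * The recursion for the drawdown from one arrival to the next *)

Section drawdown_recursion.
Context (Om : Type) (R : realType) (W : R -> Om -> R) (T : nat -> Om -> R).
Context (eta theta sigma : R) (w : Om).
Hypothesis W0 : W 0 w = 0.
Hypothesis Wc : {within `[0, +oo[, continuous (W ^~ w)}.
Hypothesis T0 : T 0%N w = 0.
Hypothesis Tlt : forall k w, T k w < T k.+1 w.

Lemma arrival_ge0 k : 0 <= T k w.
Proof. by rewrite -T0; exact: arrivals_le. Qed.

(* Extended by a constant to negative times, so as to be continuous on [R]. *)
Definition post (s : R) (w : Om) (v : R) : R := W (s + Num.max 0 v) w - W s w.

Lemma continuous_post s : 0 <= s -> continuous (post s w).
Proof.
move=> s0 v; apply: cvgB; last exact: cvg_cst.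
have g0 u : 0 <= s + Num.max 0 u by rewrite addr_ge0// le_max lexx.
have g1 u : `[0, +oo[%classic (s + Num.max 0 u) by rewrite /= in_itv/= andbT.
move/subspace_continuousP : Wc => /(_ _ (g1 v)) Wcv.
apply: (@cvg_comp _ _ _ (fun u => s + Num.max 0 u) (W^~ w) _
  (within `[0, +oo[ (nbhs (s + Num.max 0 v)))); last exact: Wcv.
have gc : continuous (fun u : R => s + Num.max 0 u).
  move=> u; apply: cvgD; first exact: cvg_cst.
  by apply: continuous_max; [exact: cvg_cst|exact: cvg_id].
move=> A hA.
have : nbhs v ((fun u => s + Num.max 0 u) @^-1` [set t | `[0, +oo[%classic t -> A t]).
  exact: gc hA.
by apply: filterS => u; apply; exact: g1.
Qed.

Section step_strategy.
Variables (B : R -> Om -> R) (b : nat -> R).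
Hypothesis Bb : forall k t, T k w <= t -> t < T k.+1 w -> B t w = b k.

Let X t := surplus W T eta theta sigma B t w.
Let f s := drift eta theta (B s w).

(** The strategy is known only through its values between arrivals, so regularity of the drift is
    built up interval by interval; integrability then allows the integral to be split at [T k]. *)
Let f_bounded k : measurable_fun `[0, T k w[ f /\
  exists M, forall s, 0 <= s < T k w -> `|f s| <= M.
Proof.
elim: k => [|k [mf [M fM]]].
  rewrite T0 set_itvco0; split; first exact: measurable_fun_set0.
  by exists 0 => s /andP[s0 /(le_lt_trans s0)]; rewrite ltxx.
have le_T : T k w <= T k.+1 w by rewrite ltW.
rewrite (@itv_bndbnd_setU _ _ (BLeft 0) (BLeft (T k w)))/=; last 2 first.
  by rewrite bnd_simp arrival_ge0.
  by rewrite bnd_simp.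
split.
  apply/measurable_funU => //; split => //.
  apply: (@eq_measurable_fun _ _ _ _ _ (cst (drift eta theta (b k)))) => //.
  by move=> s; rewrite inE/= in_itv/= /f => /andP[s1 s2]; rewrite (Bb s1 s2).
exists (Num.max M `|drift eta theta (b k)|) => s /andP[s0 sk].
rewrite le_max; have [sT|Ts] := ltP s (T k w); first by rewrite fM ?s0.
by rewrite /f (Bb Ts sk) lexx orbT.
Qed.

Let f_integrable k : lebesgue_measure.-integrable `[0, T k w[ (EFin \o f).
Proof.
have [mf [M fM]] := f_bounded k; apply: measurable_bounded_integrable => //.
  by rewrite /= lebesgue_measure_itv/=; case: ifP => // _; rewrite -EFinB ltry.
exists M; split; first exact: num_real.
move=> x Mx s; rewrite /= in_itv/= => sT; apply: le_trans (fM _ sT) _.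
exact: ltW.
Qed.

Lemma surplus_step k t : T k w <= t <= T k.+1 w ->
  X t = X (T k w) + dd_surplus eta theta sigma (b k) (post (T k w) w) (t - T k w).
Proof.
move=> /andP[kt tk]; rewrite /X /surplus /dd_surplus.
have intE : \int[lebesgue_measure]_(s in `[0, t[) f s =
    \int[lebesgue_measure]_(s in `[0, T k w[) f s + drift eta theta (b k) * (t - T k w).
  rewrite (@itv_bndbnd_setU _ _ (BLeft 0) (BLeft (T k w)))/=; last 2 first.
    by rewrite bnd_simp arrival_ge0.
    by rewrite bnd_simp.
  rewrite Rintegral_setU//=; last 2 first.
  - rewrite -itv_bndbnd_setU ?bnd_simp ?arrival_ge0//.
    apply: integrableS (f_integrable k.+1) => //.
    by apply: subset_itvl; rewrite bnd_simp.
  - apply/disj_setPRL => s /=; rewrite !in_itv/= => /andP[ks _] /andP[_].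
    by rewrite ltNge ks.
  congr (_ + _); rewrite (@eq_Rintegral _ _ _ _ _ (cst (drift eta theta (b k)))); last first.
    move=> s; rewrite inE/= in_itv/= => /andP[ks st].
    by rewrite /f (Bb ks)// (lt_le_trans st).
  rewrite Rintegral_cst//; congr (_ * _).
  rewrite /= lebesgue_measure_itv/= lte_fin; case: ltP => // tk'.
  by apply/esym/eqP; rewrite subr_eq0 eq_le kt tk'.
rewrite -/(f _) intE.
pose h s j := sigma * B (T j w) w * (W (Num.min s (T j.+1 w)) w - W (T j w) w).
have sumE s : T k w <= s <= T k.+1 w ->
    \sum_(0 <= j < (renewal_count T s w).+1) h s j =
    \sum_(0 <= j < k) h (T j.+1 w) j + sigma * b k * (W s w - W (T k w) w).
  move=> /andP[ks]; have bk : B (T k w) w = b k by apply: Bb.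
  have base : \sum_(0 <= j < k.+1) h s j =
      \sum_(0 <= j < k) h (T j.+1 w) j + sigma * b k * (W (Num.min s (T k.+1 w)) w - W (T k w) w).
    rewrite big_nat_recr//= /h bk; congr (_ + _); apply: eq_big_nat => j /andP[_ jk].
    by rewrite minxx min_r// (le_trans _ ks)// arrivals_le.
  rewrite le_eqVlt => /orP[/eqP sE|sk]; last first.
    by rewrite (renewal_countE Tlt ks sk) base min_l// ltW.
  (* At [s = T k.+1] the count has already moved to [k.+1], but the extra summand is an increment
     over a degenerate interval. *)
  have last0 : h (T k.+1 w) k.+1 = 0.
    by rewrite /h min_l ?subrr ?mulr0// ltW.
  by rewrite sE in base *; rewrite renewal_count_arrival// big_nat_recr//= last0 addr0 base minxx.
rewrite -/(h t) -/(h (T k w)) !sumE ?lexx ?kt ?tk ?(ltW (Tlt _ _))//.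
rewrite subrr mulr0 addr0 /post max_r ?subr_ge0// [T k w + _]addrC subrK.
by rewrite -!addrA; congr (_ + _); rewrite addrCA.
Qed.

Lemma surplus_imageS k : [set X s | s in `[0, T k.+1 w]] =
  [set X s | s in `[0, T k w]] `|` [set X (T k w) + y | y in
    [set dd_surplus eta theta sigma (b k) (post (T k w) w) v |
       v in `[0, T k.+1 w - T k w]]].
Proof.
apply/seteqP; split => [_ [s /= sT <-]|_ [[s /= sT <-]|[_ [v /= vT <-] <-]]].
- move: sT; rewrite in_itv/= => /andP[s0 sT].
  have [sk|ks] := leP s (T k w).
    by left; exists s => //=; rewrite in_itv/= s0.
  right; rewrite (@surplus_step k s) ?(ltW ks)//.
  eexists; last reflexivity.
  by exists (s - T k w) => //=; rewrite in_itv/= subr_ge0 (ltW ks) lerD2r.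
- exists s => //=; move: sT; rewrite !in_itv/= => /andP[-> sT] /=.
  by rewrite (le_trans sT)// ltW.
- move: vT; rewrite in_itv/= lerBrDl => /andP[v0 vT].
  exists (T k w + v); first by rewrite /= in_itv/= addr_ge0 ?arrival_ge0.
  by rewrite (@surplus_step k) ?lerDl ?v0// [T k w + v]addrC addrK.
Qed.

Lemma surplus_has_sup k : has_sup [set X s | s in `[0, T k w]].
Proof.
elim: k => [|k [[x hx] [M hM]]].
  rewrite T0 set_itv1 image_set1; split; first by exists (X 0).
  by exists (X 0) => _ ->.
have le_T : 0 <= T k.+1 w - T k w by rewrite subr_ge0 ltW.
have hY := dd_surplus_has_sup eta theta sigma (b k)
  (continuous_post (arrival_ge0 k)) le_T.
have [N hN] := hY.2.
rewrite surplus_imageS; split; first by exists x; left.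
exists (Num.max M (X (T k w) + N)) => u [/hM h|[v /hN h <-]].
  by rewrite le_max h.
by rewrite le_max lerD2l h orbT.
Qed.

(** The supremum up to [T k.+1] is the larger of the supremum up to [T k] and of [X (T k w)] plus
    the supremum of the later gain. Subtracting [X (T k w)] turns the first one, maximised with [z],
    into the drawdown at [T k]. *)
Lemma drawdown_step z k :
  drawdown W T eta theta sigma z B (T k.+1 w) w =
  dd_step eta theta sigma (drawdown W T eta theta sigma z B (T k w) w)
    (b k) (T k.+1 w - T k w) (post (T k w) w).
Proof.
have le_T : 0 <= T k.+1 w - T k w by rewrite subr_ge0 ltW.
have hY := dd_surplus_has_sup eta theta sigma (b k)
  (continuous_post (arrival_ge0 k)) le_T.
rewrite /drawdown -/(X _) -/(X (T k w)) surplus_imageS supU; last 2 first.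
- exact: surplus_has_sup.
- have [_ [N hN]] := hY; split.
    by case: hY => [[y hy] _]; exists (X (T k w) + y), y.
  by exists (X (T k w) + N) => _ [u /hN h <-]; rewrite lerD2l.
rewrite sup_addl// /dd_step maxA (@surplus_step k (T k.+1 w)) ?lexx ?andbT ?ltW//.
set M := Num.max z _; set S := sup _; set Y := dd_surplus _ _ _ _ _ _.
rewrite opprD addrA addr_maxl [X _ + S]addrC addrK.
by [].
Qed.

(** As the surplus starts at [0], a negative [z] acts like [0]; this is the origin of [Num.max z 0]
    in the cost bounds. *)
Lemma drawdown_start z : drawdown W T eta theta sigma z B (T 0%N w) w = Num.max z 0.
Proof.
have X0 : X 0 = 0.
  have N0 : renewal_count T 0 w = 0%N by rewrite -T0 renewal_count_arrival.
  have T1 : 0 <= T 1%N w by rewrite -T0 ltW.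
  by rewrite /X /surplus set_itvco0 Rintegral_set0 add0r N0 big_nat1 T0 min_l// subrr mulr0.
by rewrite /drawdown T0 -/(X 0) set_itv1 image_set1 sup1 -/(X 0) X0 subr0.
Qed.

End step_strategy.

End drawdown_recursion.

(** * Filtration and arrival times *)

Section sigma_algebra_closure.
Context (T : pointedType) (F : set_system T) (sF : sigma_algebra setT F).

Let E : measurableType _ := g_sigma_algebraType F.
Let FE : (measurable : set_system E) = F.
Proof. exact: sigma_algebra_id. Qed.

Lemma sigma_algebraI A B : F A -> F B -> F (A `&` B).
Proof. rewrite -FE; exact: measurableI. Qed.

Lemma sigma_algebraU A B : F A -> F B -> F (A `|` B).
Proof. rewrite -FE; exact: measurableU. Qed.

Lemma sigma_algebra_setC A : F A -> F (~` A).
Proof. rewrite -FE; exact: measurableC. Qed.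

Lemma sigma_algebra_setT : F setT.
Proof. rewrite -FE; exact: measurableT. Qed.

Lemma sigma_algebra_set0 : F set0.
Proof. rewrite -FE; exact: measurable0. Qed.

Lemma sigma_algebra_countable_bigcup (I : countType) (A : I -> set T) :
  (forall i, F (A i)) -> F (\bigcup_i A i).
Proof. rewrite -FE; exact: countable_bigcupT_measurable. Qed.

End sigma_algebra_closure.

Section rc_filtration.
Context d (Om : measurableType d) (R : realType).

(** The right-continuous filtration obtained from the family [S] by looking immediately beyond
    [t]. *)
Definition rc_filtration (S : R -> set_system Om) (t : R) : set_system Om :=
  [set A | forall s, t < s -> <<s S s >> A].

Variable (S : R -> set_system Om).
Hypothesis S_measurable : forall t, S t `<=` measurable.
Hypothesis S_mono : forall s t, s <= t -> S s `<=` S t.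

Lemma rc_filtration_filtration : filtration (rc_filtration S).
Proof.
split.
- move=> t t0; split.
  + by move=> s ts; exact: sigma_algebra0.
  + by move=> A hA s ts; apply: sigma_algebraCD; exact: hA.
  + by move=> A hA s ts; apply: sigma_algebra_bigcup => n; exact: hA.
- move=> t t0 A /(_ (t + 1)); rewrite ltrDl => /(_ ltr01).
  exact: (g_sigma_sub_measurable (S_measurable (t := t + 1))).
- by move=> s t s0 st A hA u tu; apply: hA; exact: le_lt_trans tu.
Qed.

Lemma rc_filtration_right_continuous : right_continuous_filtration (rc_filtration S).
Proof.
move=> t t0; apply/seteqP; split => A hA.
  by move=> s /= ts u su; apply: hA; exact: lt_trans su.
move=> s ts; have h1 : t < (t + s) / 2 by rewrite midf_lt.
have h2 : (t + s) / 2 < s by rewrite midf_lt.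
exact: (hA _ h1).
Qed.

End rc_filtration.
Arguments rc_filtration_filtration {d Om R S}.
Arguments rc_filtration_right_continuous {d Om R S}.

Section smallest_filtration.
Context d (Om : measurableType d) (R : realType).
Context (W : R -> Om -> R) (N : R -> Om -> nat).
Let G := smallest_rc_filtration W N.

Lemma smallest_filtration_sigma t : 0 <= t -> sigma_algebra setT (G t).
Proof.
move=> t0; split.
- by move=> H [[/(_ t t0)[]]].
- by move=> A GA H hH; have [[sH _ _] _ _ _] := hH; have [_ + _] := sH t t0; apply; exact: GA.
- move=> A GA H hH; have [[sH _ _] _ _ _] := hH; have [_ _] := sH t t0; apply => n; exact: GA.
Qed.

Lemma smallest_filtration_mono s t : 0 <= s -> s <= t -> G s `<=` G t.
Proof.
move=> s0 st A GA H hH; have [[_ _ mH] _ _ _] := hH.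
by apply: (mH s t s0 st); exact: GA.
Qed.

Lemma smallest_filtrationW s t A : 0 <= s -> s <= t -> measurable A -> G t (W s @^-1` A).
Proof.
move=> s0 st mA; apply: (smallest_filtration_mono s0 st) => H [_ _ aW _].
exact: aW.
Qed.

Lemma smallest_filtrationN s t A : 0 <= s -> s <= t -> G t (N s @^-1` A).
Proof.
move=> s0 st; apply: (smallest_filtration_mono s0 st) => H [_ _ _ aN].
exact: aN.
Qed.

(** It suffices that [rc_filtration S] is one of the filtrations intersected. [S] may know more than
    [W] and [N] up to [t]: it is used with all arrival times added, and with the whole path of [W]
    added. *)
Lemma smallest_filtration_sub (S : R -> set_system Om) t :
  (forall t, S t `<=` measurable) -> (forall s t, s <= t -> S s `<=` S t) ->
  (forall t A, 0 <= t -> measurable A -> <<s S t >> (W t @^-1` A)) ->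
  (forall t A, 0 <= t -> <<s S t >> (N t @^-1` A)) ->
  0 <= t -> G t `<=` rc_filtration S t.
Proof.
move=> mS S_mono SW SN t0 A; apply; split.
- exact: rc_filtration_filtration.
- exact: rc_filtration_right_continuous.
- move=> u u0 B mB s us; apply: (sub_sigma_algebra2 (S_mono _ _ (ltW us))).
  exact: SW.
- move=> u u0 B mB s us; apply: (sub_sigma_algebra2 (S_mono _ _ (ltW us))).
  exact: SN.
Qed.

End smallest_filtration.

Section renewal.
Context d (Om : measurableType d) (R : realType) (T : nat -> Om -> R).
Hypothesis T0 : forall w, T 0%N w = 0.
Hypothesis Tlt : forall k w, T k w < T k.+1 w.
Let N := renewal_count T.

Lemma exists_renewal_count k t w : 0 <= t -> t < T k w ->
  exists2 j, (j < k)%N & T j w <= t < T j.+1 w.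
Proof.
move=> t0; elim: k => [|k IH tk]; first by rewrite T0 ltNge t0.
have [/IH[j jk h]|kt] := ltP t (T k w); first by exists j; rewrite // ltnW.
by exists k => //; rewrite kt.
Qed.

Lemma renewal_count_leP k t w : 0 <= t -> (k <= N t w)%N -> T k w <= t.
Proof.
move=> t0; rewrite /N /renewal_count; case: xgetP => [j _ [jt _] kj|_].
  exact: le_trans (arrivals_le Tlt w kj) jt.
by rewrite leqn0 => /eqP ->; rewrite T0.
Qed.

(* The rational times serve the paths whose arrival times accumulate before [t]:
   there [N t = 0], the junk value of [renewal_count]. *)
Lemma arrival_leE k t : 0 <= t -> [set w | T k w <= t] =
  [set w | (k <= N t w)%N] `|`
  \bigcup_(q : rat) (if 0 <= (ratr q : R) <= t then [set w | (k <= N (ratr q) w)%N] else set0).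
Proof.
move=> t0; apply/seteqP; split => w /=.
  move=> kt; have [tk|tk] := ltP t (T k.+1 w).
    by left; rewrite /N (renewal_countE Tlt kt tk).
  right; have /rat_in_itvoo[q /itvP qT] := Tlt k w.
  exists q => //; rewrite (le_trans (arrival_ge0 (T0 w) Tlt k)) ?qT//=.
  rewrite (le_trans _ tk) ?qT//=.
  by rewrite /N (renewal_countE Tlt (k := k)) ?qT.
case; first exact: renewal_count_leP.
by case=> q _; case: ifPn => // /andP[q0 qt] /(renewal_count_leP q0) /le_trans; exact.
Qed.

Lemma renewal_count_preimage t k : 0 <= t -> (0 < k)%N ->
  [set w | N t w = k] = [set w | T k w <= t] `&` [set w | t < T k.+1 w].
Proof.
move=> t0 k0; apply/seteqP; split => w /=; last by case=> h1 h2; exact: renewal_countE.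
rewrite /N /renewal_count; case: xgetP => [j _ [h1 h2] <- //|_ k0'].
by rewrite -k0' in k0.
Qed.

Lemma renewal_count_sigma (F : set_system Om) t A : sigma_algebra setT F ->
  0 <= t -> (forall k c, F [set w | T k w <= c]) -> F (N t @^-1` A).
Proof.
move=> sF t0 FT.
have Fk k : F [set w | N t w = k.+1].
  rewrite renewal_count_preimage//; apply: sigma_algebraI => //.
  rewrite (_ : [set w | t < _] = ~` [set w | T k.+2 w <= t]).
    exact: sigma_algebra_setC.
  by apply/seteqP; split => w /=; rewrite ltNge => /negP.
(* The fibre over [0] also contains the paths with default count, so it is obtained as the
   complement of the other fibres. *)
have F0 : F [set w | N t w = 0%N].
  rewrite (_ : [set w | _] = ~` \bigcup_k [set w | N t w = k.+1]).
    by apply: sigma_algebra_setC => //; exact: sigma_algebra_countable_bigcup.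
  apply/seteqP; split => w /=; first by move=> Nw [n _ /=]; rewrite Nw.
  by case Nw : (N t w) => [//|n] h; exfalso; apply: h; exists n.
rewrite (_ : _ @^-1` A = \bigcup_(k : nat) (if pselect (A k) then [set w | N t w = k] else set0)).
  apply: sigma_algebra_countable_bigcup => // k; case: pselect => /= [Ak|nAk]; last first.
    exact: sigma_algebra_set0.
  by case: k {Ak}.
apply/seteqP; split => w /=.
  by move=> h; exists (N t w) => //; case: pselect.
by case=> k _; case: pselect => //= Ak Nk; rewrite Nk.
Qed.

Lemma renewal_count_trace k s v A (L : set_system Om) : sigma_algebra setT L ->
  0 <= v -> v <= s -> (forall j c, (j <= k)%N -> L [set w | T j w <= c]) ->
  exists2 A', L A' & N v @^-1` A `&` [set w | T k w <= s /\ s < T k.+1 w] =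
    A' `&` [set w | T k w <= s /\ s < T k.+1 w].
Proof.
move=> sL v0 vs LT.
pose C j := if (j < k)%N then [set w | T j w <= v] `&` ~` [set w | T j.+1 w <= v]
  else if j == k then [set w | T k w <= v] else set0.
have CE j w : s < T k.+1 w -> C j w -> N v w = j.
  move=> sk; rewrite /C; case: ifPn => [jk [h1 /negP]|_].
    by rewrite -ltNge => h2; exact: renewal_countE.
  case: eqP => // -> h; apply: renewal_countE => //; exact: le_lt_trans sk.
exists (\bigcup_(j : nat) (if pselect (A j) then C j else set0)).
  apply: sigma_algebra_countable_bigcup => // j; case: pselect => /= [Aj|nAj]; last first.
    exact: sigma_algebra_set0.
  rewrite /C; case: ifPn => [jk|_].
    apply: sigma_algebraI => //; first by apply: LT; exact: ltnW.
    by apply: sigma_algebra_setC => //; exact: LT.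
  case: ifPn => _; [exact: LT|exact: sigma_algebra_set0].
apply/seteqP; split => w [h [ks sk]]; split => //; last first.
  case: h => j _; case: pselect => //= Aj Cj.
  by rewrite (CE _ _ sk Cj).
have [j jk /andP[h1 h2]] := exists_renewal_count v0 (le_lt_trans vs sk).
exists j => //; have Nj : N v w = j by exact: renewal_countE.
case: pselect => /= [Aj|]; last by rewrite -Nj.
rewrite /C; move: jk; rewrite ltnS leq_eqVlt => /orP[/eqP jk|->].
  by rewrite jk ltnn eqxx -jk.
by split => //=; apply/negP; rewrite -ltNge.
Qed.

End renewal.

Section stopped.
Context d (Om : measurableType d) (R : realType).
Context (W : R -> Om -> R) (T : nat -> Om -> R).
Hypothesis T0 : forall w, T 0%N w = 0.
Hypothesis Tlt : forall k w, T k w < T k.+1 w.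
Let N := renewal_count T.
Let G := smallest_rc_filtration W N.

Lemma smallest_filtration_arrival k s t : 0 <= s -> s <= t -> G t [set w | T k w <= s].
Proof.
move=> s0 st; have t0 := le_trans s0 st.
have sG := smallest_filtration_sigma W N t0.
have GN u : 0 <= u -> u <= t -> G t [set w | (k <= N u w)%N].
  by move=> u0 ut; exact: (@smallest_filtrationN _ _ _ W N _ _ [set n | (k <= n)%N] u0 ut).
rewrite arrival_leE//; apply: (sigma_algebraU sG); first exact: GN.
apply: (sigma_algebra_countable_bigcup sG) => q; case: ifPn; last first.
  by move=> _; exact: (sigma_algebra_set0 sG).
by move=> /andP[q0 qs]; apply: GN => //; exact: le_trans st.
Qed.

(** An event known at [q] in the right-continuous filtration belongs to the sigma-algebra of [S s]
    only for [s > q]. Hence the strict [T k w < s], exhausted by the events [T k w <= q] with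
    [q < s] rational. *)
Lemma stopped_sub (S : R -> set_system Om) k A s :
  (forall t, S t `<=` measurable) -> (forall s t, s <= t -> S s `<=` S t) ->
  (forall t A, 0 <= t -> measurable A -> <<s S t >> (W t @^-1` A)) ->
  (forall t A, 0 <= t -> <<s S t >> (N t @^-1` A)) ->
  stopped_sigma_algebra G (T k) A -> <<s S s >> (A `&` [set w | T k w < s]).
Proof.
move=> mS S_mono SW SN [mA AG].
rewrite (_ : _ `&` _ = \bigcup_(q : rat) (if 0 <= (ratr q : R) < s then
    A `&` [set w | T k w <= ratr q] else set0)).
  apply: sigma_algebra_countable_bigcup => [|q]; first exact: smallest_sigma_algebra.
  case: ifPn => [/andP[q0 qs]|_]; last exact: sigma_algebra0.
  exact: (smallest_filtration_sub mS S_mono SW SN q0 (AG _ q0)).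
apply/seteqP; split => [w [Aw /= Ts]|w [q _]].
  have /rat_in_itvoo[q /itvP qT] := Ts.
  exists q => //; rewrite (le_trans (arrival_ge0 (T0 w) Tlt k)) ?qT//=.
  by split => //=; rewrite qT.
by case: ifPn => // /andP[q0 qs] [Aw /= Tq]; split => //=; exact: le_lt_trans qs.
Qed.

End stopped.

Lemma sigma_algebra_preimage_le (T : pointedType) (R : realType) (F : set_system T)
    (f : T -> R) : sigma_algebra setT F -> (forall c, F [set w | f w <= c]) ->
  forall B, measurable B -> F (f @^-1` B).
Proof.
move=> sF Ff B mB.
pose E : measurableType _ := g_sigma_algebraType F.
have FE : (measurable : set_system E) = F by exact: sigma_algebra_id.
have mf : measurable_fun setT (f : E -> R).
  apply: (measurability _ (RGenOInfty.measurableE R)) => //.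
  move=> _ [_ [c ->] <-]; rewrite setTI FE.
  rewrite (_ : _ @^-1` _ = ~` [set w | f w <= c]); first exact: sigma_algebra_setC.
  by apply/seteqP; split => w /=; rewrite in_itv/= andbT ltNge => /negP.
by rewrite -FE -[X in _ X]setTI; exact: mf.
Qed.

Section independent3.
Context d (Om : measurableType d) (R : realType) (P : probability Om R).

(** The intersections of a member of [F1] with a member of [F2] form a pi-system that generates the
    left-hand sigma-algebra. *)
Lemma independent_systems3 (F1 F2 F3 : set_system Om) :
  sigma_algebra setT F1 -> sigma_algebra setT F2 -> F1 `<=` measurable ->
  F2 `<=` measurable -> F3 `<=` measurable ->
  (forall A B C, F1 A -> F2 B -> F3 C -> P (A `&` B `&` C) = (P A * P B * P C)%E) ->
  (forall A B, F1 A -> F2 B -> P (A `&` B) = (P A * P B)%E) ->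
  independent_systems P <<s F1 `|` F2 >> F3.
Proof.
move=> s1 s2 m1 m2 m3 F123 F12.
pose F := [set A `&` B | A in F1 & B in F2].
have FF : <<s F1 `|` F2 >> `<=` <<s F >>.
  apply: sub_sigma_algebra2 => A [FA|FA].
    by exists A => //; exists setT; rewrite ?setIT//; exact: sigma_algebra_setT.
  by exists setT; [exact: sigma_algebra_setT|exists A => //; rewrite setTI].
apply: (@independent_systemsS _ _ _ P _ _ _ _ FF (@subset_refl _ F3)).
apply: independent_systems_sigmal => //.
- move=> _ _ [A FA [B FB <-]] [A' FA' [B' FB' <-]].
  exists (A `&` A'); first exact: sigma_algebraI.
  by exists (B `&` B'); [exact: sigma_algebraI|rewrite setIACA].
- by move=> _ [A /m1 mA [B /m2 mB <-]]; exact: measurableI.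
- by move=> _ C [A FA [B FB <-]] FC; rewrite F123// F12.
Qed.

End independent3.

Definition to_path (R : realType) (f : R -> R) : cpath R :=
  if pselect (continuous f) is left fc then [the continuousType R R of mkcts fc]
  else point.

Lemma to_pathE (R : realType) (f : R -> R) v : continuous f -> to_path f v = f v.
Proof. by move=> fc; rewrite /to_path; case: pselect. Qed.

(** * Approximation of cylinders of the path space *)

Section ray_cylinders.
Context (R : realType).
Implicit Types (S : seq (R * R)).

(* Cylinders over open rays generate, and their indicators are increasing limits
   of the functions [soft_cylinder m S], which are continuous in the path; this
   is what lets [T k] be approached by discrete times from above. *)
Definition ray_cylinder S : set (path_space R) :=
  [set x | forall p, p \in S -> p.2 < x p.1].

Lemma ray_cylinder_setI_closed : setI_closed (range ray_cylinder).
Proof.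
move=> _ _ [S1 _ <-] [S2 _ <-]; exists (S1 ++ S2) => //.
apply/seteqP; split => [x h|x [h1 h2] p]; last by rewrite mem_cat => /orP[/h1|/h2].
by split=> p hp; apply: h; rewrite mem_cat hp ?orbT.
Qed.

Lemma ray_cylinder_measurable S : measurable (ray_cylinder S).
Proof.
rewrite (_ : ray_cylinder S = \bigcap_(p in [set` S]) (path_at p.1 @^-1` `]p.2, +oo[)).
  rewrite bigcap_seq; apply: bigsetI_measurable => p _.
  by rewrite -[X in measurable X]setTI; apply: measurable_path_at.
by apply/seteqP; split => x h p /h; rewrite /path_at/= in_itv/= andbT.
Qed.

Lemma ray_cylinder_generates :
  (measurable : set_system (path_space R)) = <<s range ray_cylinder >>.
Proof.
apply/seteqP; split; last first.
  apply: g_sigma_sub_measurable => _ [S _ <-]; exact: ray_cylinder_measurable.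
apply: smallest_sub; first exact: smallest_sigma_algebra.
move=> _ [v _ [A mA <-]]; rewrite setTI.
have sF := @smallest_sigma_algebra (path_space R) setT (range ray_cylinder).
apply: (sigma_algebra_preimage_le sF) mA => c.
rewrite (_ : [set w | _] = ~` ray_cylinder [:: (v, c)]).
  by apply: (sigma_algebra_setC sF); apply: sub_sigma_algebra; exists [:: (v, c)].
apply/seteqP; split => x; rewrite /path_at/=.
  by move=> xc /(_ (v, c)); rewrite mem_head/= => /(_ isT); rewrite ltNge xc.
move=> h; rewrite leNgt; apply/negP => cx; apply: h => p.
by rewrite inE => /eqP ->.
Qed.

Definition ramp (m : nat) (y : R) : R := Num.min 1 (Num.max 0 (m%:R * y)).

Lemma ramp_01 m y : 0 <= ramp m y <= 1.
Proof. by rewrite /ramp le_min ler01 le_max lexx/= ge_min lexx. Qed.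

Lemma continuous_ramp m : continuous (ramp m).
Proof.
have cc (c : R) : continuous (fun _ : R => c) by move=> z; exact: cvg_cst.
have cm : continuous (fun y : R => m%:R * y) by move=> z; apply: cvgMr; exact: cvg_id.
move=> y.
have := @continuous_min _ _ _ _ y (cc 1 y) (@continuous_max _ _ _ _ y (cc 0 y) (cm y)).
exact.
Qed.

Lemma ramp_cvg y : ramp m y @[m --> \oo] --> ((0 < y)%R%:R : R).
Proof.
have [y0|y0] := ltP 0 y; last first.
  rewrite (_ : (fun m => ramp m y) = cst 0); first exact: cvg_cst.
  apply/funext => m; rewrite /ramp max_l ?min_r ?ler01//.
  by rewrite mulr_ge0_le0.
apply: cvg_near_cst; exists (Num.truncn y^-1).+1 => //= m /= hm.
have : 1 <= m%:R * y.
  rewrite -ler_pdivrMr// div1r; apply: (@le_trans _ _ (Num.truncn y^-1).+1%:R).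
    by rewrite ltW// truncnS_gt.
  by rewrite ler_nat.
move=> my; rewrite /ramp max_r ?min_l//; exact: le_trans my.
Qed.

Definition soft_cylinder m S (x : R -> R) : R := \prod_(p <- S) ramp m (x p.1 - p.2).

Lemma soft_cylinder_01 m S x : 0 <= soft_cylinder m S x <= 1.
Proof.
rewrite /soft_cylinder; elim: S => [|p S /andP[h0 h1]]; first by rewrite big_nil ler01 lexx.
have /andP[r0 r1] := ramp_01 m (x p.1 - p.2).
by rewrite big_cons mulr_ge0//= mulr_ile1.
Qed.

Lemma measurable_soft_cylinder m S :
  measurable_fun setT ((fun x => soft_cylinder m S x) : path_space R -> R).
Proof.
rewrite /soft_cylinder; elim: S => [|p S IH].
  by under eq_fun do rewrite big_nil; exact: measurable_cst.
under eq_fun do rewrite big_cons; apply: measurable_funM => //.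
apply: (measurableT_comp (continuous_measurable_fun (@continuous_ramp m))).
by apply: measurable_funB => //; exact: measurable_path_at.
Qed.

Lemma soft_cylinder_cvg_path m S (x : nat -> R -> R) (y : R -> R) :
  (forall v, x n v @[n --> \oo] --> y v) ->
  soft_cylinder m S (x n) @[n --> \oo] --> soft_cylinder m S y.
Proof.
move=> xy; rewrite /soft_cylinder; elim: S => [|p S IH].
  by under eq_fun do rewrite big_nil; rewrite big_nil; exact: cvg_cst.
under eq_fun do rewrite big_cons; rewrite big_cons; apply: cvgM => //.
apply: continuous_cvg; first exact: continuous_ramp.
by apply: cvgB => //; exact: cvg_cst.
Qed.

Lemma soft_cylinder_cvg_indic S (x : path_space R) :
  soft_cylinder m S x @[m --> \oo] --> (\1_(ray_cylinder S) x : R).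
Proof.
rewrite /soft_cylinder; elim: S => [|p S IH].
  under eq_fun do rewrite big_nil.
  rewrite (_ : \1__ x = 1); first exact: cvg_cst.
  by rewrite indicE mem_set.
under eq_fun do rewrite big_cons.
rewrite (_ : \1__ x = (0 < x p.1 - p.2)%R%:R * \1_(ray_cylinder S) x).
  by apply: cvgM => //; exact: ramp_cvg.
rewrite !indicE -natrM mulnb; congr (_%:R); congr nat_of_bool.
apply/idP/andP => [|[h1 h2]]; rewrite !inE.
  move=> h; split; first by rewrite subr_gt0 h// mem_head.
  by move=> q hq; apply: h; rewrite inE hq orbT.
move=> q; rewrite inE => /orP[/eqP ->|]; first by rewrite -subr_gt0.
exact: (set_mem h2).
Qed.

End ray_cylinders.

(** * Limits of integrals and iteration of one-step inequalities *)

Lemma unit_bounded_cvg_integral d (Om : measurableType d) (R : realType)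
    (P : probability Om R) (B : set Om) (f_ : nat -> Om -> R) (f : Om -> R) :
  measurable B -> (forall n, measurable_fun setT (f_ n)) ->
  (forall n w, 0 <= f_ n w <= 1) -> (forall w, f_ n w @[n --> \oo] --> f w) ->
  (\int[P]_(w in B) (f_ n w)%:E @[n --> \oo] --> \int[P]_(w in B) (f w)%:E)%E.
Proof.
move=> mB mf_ f01 f_f.
apply: (@dominated_cvg _ _ _ P B mB (fun n w => (f_ n w)%:E) (fun w => (f w)%:E) (cst 1%E)).
- by move=> n; apply/measurable_EFinP; exact: measurable_funTS.
- by move=> w _; apply: cvg_EFin; [exact: nearW|exact: f_f].
- by [].
- exact: finite_measure_integrable_cst.
- move=> n w _; rewrite /= lee_fin.
  by have /andP[h0 h1] := f01 n w; rewrite ger0_norm.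
Qed.

Lemma bounded_nondecreasing_emeasurable (R : realType) (u : R -> \bar R) (C : R) :
  (forall x, 0 <= u x <= C%:E)%E -> {homo u : x y / (x <= y)%R >-> (x <= y)%E} ->
  measurable_fun setT u.
Proof.
move=> uC u_mono.
have ufin x : u x \is a fin_num.
  by have /andP[h1 h2] := uC x; rewrite ge0_fin_numE// (le_lt_trans h2)// ltry.
rewrite (_ : u = EFin \o (fine \o u)); last by apply/funext => x /=; rewrite fineK.
apply/measurable_EFinP; apply: nondecreasing_measurable => // x y xy /=.
by rewrite fine_le// u_mono.
Qed.

Lemma le_partial_sum (R : realType) (a c : nat -> \bar R) :
  (forall k, a k <= c k + a k.+1)%E ->
  forall n, (a 0%N <= \sum_(0 <= k < n) c k + a n)%E.
Proof.
move=> step; elim=> [|n IH]; first by rewrite big_nil add0e.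
by rewrite big_nat_recr//= -addeA; apply: le_trans IH _; exact: leeD2l.
Qed.

(** The term [e * q ^+ n / (1 - q)] is the tail of the geometric series of errors not yet spent;
    carrying it on the left makes the induction exact. *)
Lemma partial_sum_le (R : realType) (a c : nat -> \bar R) (e q : R) : 0 < 1 - q ->
  (forall k, c k + a k.+1 <= a k + (e * q ^+ k)%R%:E)%E ->
  forall n, (\sum_(0 <= k < n) c k + a n + (e * q ^+ n / (1 - q))%R%:E <=
             a 0%N + (e / (1 - q))%R%:E)%E.
Proof.
move=> q1 step; elim=> [|n IH]; first by rewrite big_nil add0e expr0 mulr1.
apply: le_trans IH; rewrite big_nat_recr//= -!addeA leeD2l// addeA.
apply: le_trans (leeD2r _ (step n)) _; rewrite -addeA leeD2l// -EFinD lee_fin.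
rewrite exprS le_eqVlt; apply/orP; left; apply/eqP; field.
by rewrite gt_eqF.
Qed.

(** * Measurable selection *)

Section measurable_selection.
Context (R : realType).

(** Taking the least admissible index makes the pieces disjoint and keeps them measurable. *)
Lemma countable_selection (Q : nat -> set R) (beta : nat -> R) :
  (forall n, measurable (Q n)) -> (forall z, exists n, Q n z) ->
  exists2 s : R -> R, measurable_fun setT s & forall z, exists2 n, Q n z & s z = beta n.
Proof.
move=> mQ exQ.
have exQb z : exists n, `[< Q n z >] by have [n Qn] := exQ z; exists n; exact/asboolP.
pose k z := ex_minn (exQb z).
exists (fun z => beta (k z)); last first.
  by move=> z; exists (k z) => //; rewrite /k; case: ex_minnP => n /asboolP.
move=> _ A mA; rewrite setTI.
rewrite (_ : _ @^-1` A = \bigcup_n (if pselect (A (beta n)) then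
    Q n `&` \bigcap_(i in [set i | (i < n)%N]) ~` Q i else set0)).
  apply: bigcupT_measurable => n; case: pselect => //= _; apply: measurableI => //.
  by rewrite bigcap_mkcond; apply: bigcapT_measurable => i; case: ifPn => // _; exact: measurableC.
apply/seteqP; split => z /=.
  move=> Az; exists (k z) => //; case: pselect => //= _.
  rewrite /k; case: ex_minnP => n /asboolP Qn nmin; split => // i /= i_n Qi.
  by have := nmin i; rewrite leqNgt i_n => /(_ (asboolT Qi)).
case=> n _; case: pselect => //= Abn [Qn nQ].
suff -> : k z = n by [].
rewrite /k; case: ex_minnP => m /asboolP Qm mmin; apply/eqP; rewrite eqn_leq.
rewrite mmin ?(asboolT Qn)//= leqNgt; apply/negP => mn; exact: (nQ m mn).
Qed.

(* Only monotonicity in [z] is used, not continuity in [b]: on the down-closed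
   set where the infimum is below a given level, an almost optimal [b] at [c]
   is almost optimal at every smaller [z] whose infimum is near that level, and
   countably many points [c] are cofinal in that set. *)
Lemma monotone_selector (h : R -> R -> \bar R) (M e : R) : 0 < e ->
  (forall z b, 0 <= h z b <= M%:E)%E ->
  (forall b z z', (z <= z')%R -> h z b <= h z' b)%E ->
  exists s : R -> R, [/\ measurable_fun setT s, forall z, 0 <= s z <= 1 &
    forall z, (h z (s z) <= ereal_inf [set h z b | b in `[0%R, 1%R]] + e%:E)%E].
Proof.
move=> e0 hM h_mono; pose G z := ereal_inf [set h z b | b in `[0%R, 1%R]].
have i01 : `[0%R, 1%R]%classic (0 : R) by rewrite /= in_itv/= lexx ler01.
have G0 z : (0 <= G z)%E.
  by apply: le_ereal_inf_tmp => _ [b _ <-]; have /andP[] := hM z b.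
have GM z : (G z <= M%:E)%E.
  apply: (@le_trans _ _ (h z 0%R)); last by have /andP[] := hM z 0.
  by apply: ereal_inf_lbound; exists 0.
have Gfin z : G z \is a fin_num by rewrite ge0_fin_numE// (le_lt_trans (GM z))// ltry.
have G_mono z z' : z <= z' -> (G z <= G z')%E.
  move=> zz'; apply: le_ereal_inf_tmp => _ [b bi <-]; apply: (le_trans _ (h_mono b _ _ zz')).
  by apply: ereal_inf_lbound; exists b.
pose g z := fine (G z).
(* One half of [e] pays for near optimality at [c], the other for the width of a level. *)
pose dl := e / 2; have dl0 : 0 < dl by rewrite divr_gt0.
have bP c : exists2 b, 0 <= b <= 1 & (h c b < G c + dl%:E)%E.
  have [_ [b bi <-] hb] := lb_ereal_inf_adherent dl0 (Gfin c).
  by exists b => //; move: bi; rewrite /= in_itv.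
pose b_ c := projT1 (cid2 (bP c)).
have b01 c : 0 <= b_ c <= 1 by rewrite /b_; case: cid2.
have bh c : (h c (b_ c) < G c + dl%:E)%E by rewrite /b_; case: cid2.
pose I (i : nat) : set R := [set z | g z < i.+1%:R * dl].
(* Cofinal points of the down-closed set [I i]: its maximum if there is one ([None]), otherwise a
   member above each rational that leaves room for one ([Some q]). *)
pose c_ (j : nat * option rat) : R :=
  if j.2 is Some q then xget 0 (I j.1 `&` [set x | ratr q <= x])
  else xget 0 (I j.1 `&` [set x | forall y, I j.1 y -> y <= x]).
(* The test discards the indices for which [xget] fell back on [0] and [0] lies outside the level
   set. *)
pose Qj (j : nat * option rat) : set R :=
  if pselect (I j.1 (c_ j)) then [set z | z <= c_ j] `&` [set z | j.1%:R * dl <= g z] else set0.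
pose Q n := if unpickle n is Some j then Qj j else set0.
pose beta n := if unpickle n is Some j then b_ (c_ j) else 0.
have mg : measurable_fun setT g.
  apply: nondecreasing_measurable => // x y xy; rewrite /g fine_le//; exact: G_mono.
have mQ n : measurable (Q n).
  rewrite /Q; case: unpickle => // j; rewrite /Qj; case: pselect => //= _.
  apply: measurableI.
    rewrite (_ : [set z | z <= c_ j] = `]-oo, c_ j]%classic); first exact: measurable_itv.
    by apply/seteqP; split => z /=; rewrite in_itv.
  rewrite (_ : [set z | j.1%:R * dl <= g z] = g @^-1` `[j.1%:R * dl, +oo[).
    by rewrite -[X in measurable X]setTI; exact: mg.
  by apply/seteqP; split => z /=; rewrite in_itv/= andbT.
have exQ z : exists n, Q n z.
  suff [j Qz] : exists j, Qj j z by exists (pickle j); rewrite /Q pickleK.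
  pose i := Num.truncn (g z / dl).
  have g0 : 0 <= g z / dl by rewrite divr_ge0 ?fine_ge0// ltW.
  have /andP[i1 i2] := truncn_itv g0.
  have Iz : I i z by rewrite /I/= -ltr_pdivrMr.
  have ig : i%:R * dl <= g z by rewrite -ler_pdivlMr.
  have [mx|nmx] := pselect (exists x, I i x /\ forall y, I i y -> y <= x).
    exists (i, None); rewrite /Qj /c_/=; case: xgetP => [x _ [Ix Imax]|no]; last first.
      by case: mx => x [Ix Imax]; case: (no x).
    by case: pselect => //= _; split => //=; exact: Imax.
  have [x [Ix zx]] : exists x, I i x /\ z < x.
    apply: contrapT => no; apply: nmx; exists z; split => // y Iy.
    by rewrite leNgt; apply/negP => zy; apply: no; exists y.
  have /rat_in_itvoo[q /itvP qzx] := zx.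
  exists (i, Some q); rewrite /Qj /c_/=; case: xgetP => [y _ [Iy qy]|no]; last first.
    by case: (no x); split => //=; rewrite qzx.
  by case: pselect => //= _; split => //=; rewrite (le_trans _ qy)// qzx.
have [s ms sQ] := countable_selection beta mQ exQ.
exists s; split => // z; have [n] := sQ z; rewrite /Q /beta; case: unpickle => // j Qz sE.
  by rewrite sE.
rewrite sE; move: Qz; rewrite /Qj; case: pselect => //= Ic [/= zc jg].
apply: le_trans (h_mono _ _ _ zc) _; apply: le_trans (ltW (bh _)) _.
rewrite -(fineK (Gfin (c_ j))) -/(G z) -(fineK (Gfin z)) -!EFinD lee_fin.
apply: (@le_trans _ _ (j.1.+1%:R * dl + dl)); first by rewrite lerD2r ltW.
have -> : e = dl + dl by rewrite /dl -splitr.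
by rewrite -natr1 mulrDl mul1r -addrA lerD2r.
Qed.

End measurable_selection.

(** * Strong Markov property at the arrival times *)

Section controlled_drawdown.
Context d (Om : measurableType d) (R : realType) (P : probability Om R).
Context (W : R -> Om -> R) (T : nat -> Om -> R).
Hypothesis W_brownian : brownian_motion P W.
Hypothesis T_renewal : renewal_arrivals P T.
Hypothesis WN_independent : independent_systems P
     (sigma_process `[0, +oo[ W) (sigma_process `[0, +oo[ (renewal_count T)).
Let N := renewal_count T.
Let G := smallest_rc_filtration W N.

Let mW t : 0 <= t -> measurable_fun setT (W t).
Proof. by case: W_brownian => + _ _ _ _; exact. Qed.
Let W0 w : W 0 w = 0. Proof. by case: W_brownian => _ + _ _ _; exact. Qed.
Let Wc w : {within `[0, +oo[, continuous (W ^~ w)}.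
Proof. by case: W_brownian => _ _ + _ _; exact. Qed.
Let mT k : measurable_fun setT (T k). Proof. by case: T_renewal => + _ _ _ _; exact. Qed.
Let T0 w : T 0%N w = 0. Proof. by case: T_renewal => _ + _ _ _; exact. Qed.
Let Tlt k w : T k w < T k.+1 w. Proof. by case: T_renewal => _ _ + _ _; exact. Qed.
Let Tk0 k w : 0 <= T k w. Proof. exact: (arrival_ge0 (T0 w) Tlt). Qed.

Lemma sigma_gen_W_measurable (J : set R) : J `<=` `[0, +oo[ ->
  sigma_gen J W `<=` measurable.
Proof.
move=> J0 _ [t /J0 t0 [A mA <-]]; apply: mW => //.
by move: t0; rewrite /= in_itv/= andbT.
Qed.

(** The hypothesis concerns the counting process; the arrival times are recovered from it, since
    each event [T k w <= c] is a countable combination of events on the counts. *)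
Lemma independent_W_arrivals : independent_systems P
  <<s sigma_gen `[0, +oo[ W >> <<s sigma_gen setT T >>.
Proof.
apply: independent_systemsS WN_independent => //.
apply: smallest_sub; first exact: smallest_sigma_algebra.
move=> _ [k _ [A mA <-]]; rewrite setTI.
have sF : sigma_algebra setT (sigma_process `[0, +oo[ N).
  exact: smallest_sigma_algebra.
apply: (sigma_algebra_preimage_le sF) mA => c.
have [c0|c0] := leP 0 c; last first.
  rewrite (_ : [set w | T k w <= c] = set0); first exact: (sigma_algebra_set0 sF).
  apply/seteqP; split => w //= Tc.
  have := le_lt_trans (le_trans (arrival_ge0 (T0 w) Tlt k) Tc) c0.
  by rewrite ltxx.
have FN u : 0 <= u -> sigma_process `[0, +oo[ N [set w | (k <= N u w)%N].
  move=> u0; apply: sub_sigma_algebra; exists u; first by rewrite /= in_itv/= u0.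
  by exists [set n | (k <= n)%N] => //; rewrite setTI.
rewrite arrival_leE//; apply: (sigma_algebraU sF); first exact: FN.
apply: (sigma_algebra_countable_bigcup sF) => q; case: ifPn => [/andP[q0 _]|_].
  exact: FN.
exact: (sigma_algebra_set0 sF).
Qed.

Definition interarrival k w := T k.+1 w - T k w.

Lemma measurable_interarrival k : measurable_fun setT (interarrival k).
Proof. by apply: measurable_funB; exact: mT. Qed.

(** For [j <= k], [T j] is a sum of interarrival times of index below [k]. *)
Lemma independent_arrivals_interarrival k : independent_systems P
  <<s sigma_gen [set j | (j <= k)%N] T >> <<s sigma_gen [set k] interarrival >>.
Proof.
have [_ _ _ iT _] := T_renewal.
have disj i : [set j | (j < k)%N] i -> [set k] i -> False.
  by move=> /= + ik; rewrite ik ltnn.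
apply: independent_systemsS (mutually_independent_grouping measurable_interarrival iT disj) => //.
apply: smallest_sub; first exact: smallest_sigma_algebra.
move=> _ [j /= jk [A mA <-]].
pose E := g_sigma_algebraType (sigma_gen [set j | (j < k)%N] interarrival).
have : measurable_fun setT ((fun w => T j w - T 0%N w) : E -> R).
  apply: (@measurable_telescope _ E R T 0 j) => // i /= ij.
  move=> _ B mB; apply: sub_sigma_algebra; exists i; first exact: leq_trans jk.
  by exists B.
move=> /(_ measurableT A mA).
suff -> : (fun w => T j w - T 0%N w) = T j by [].
by apply/funext => w; rewrite T0 subr0.
Qed.

Lemma P_interarrival k A : measurable A -> P (interarrival k @^-1` A) = P (T 1%N @^-1` A).
Proof. by case: T_renewal => _ _ _ _; exact. Qed.

Definition past_and_arrivals s := sigma_gen `[0, s] W `|` sigma_gen setT T.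
Definition path_and_arrivals k :=
  sigma_gen `[0, +oo[ W `|` sigma_gen [set j | (j <= k)%N] T.

Lemma g_sigmaU_sub (F1 F2 : set_system Om) :
  <<s F1 `|` F2 >> `<=` <<s <<s F1 >> `|` <<s F2 >> >>.
Proof.
apply: sub_sigma_algebra2 => A [FA|FA]; [left|right]; exact: sub_sigma_algebra.
Qed.

(** The past of [W], the arrivals and the later increments factor jointly: [W] is first separated
    from the arrivals, then its past from its future. *)
Lemma independent_past_future s : 0 <= s ->
  independent_systems P <<s past_and_arrivals s >> <<s sigma_gen `[0, +oo[ (later W s) >>.
Proof.
move=> s0.
have sub0 : `[0, s]%classic `<=` `[0, +oo[%classic by exact: subset_itvl.
have subW : <<s sigma_gen `[0, s] W >> `<=` <<s sigma_gen `[0, +oo[ W >>.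
  by apply: sub_sigma_algebra2 => A [v /sub0 v0 h]; exists v.
have subF : <<s sigma_gen `[0, +oo[ (later W s) >> `<=` <<s sigma_gen `[0, +oo[ W >>.
  apply: smallest_sub; first exact: smallest_sigma_algebra.
  move=> _ [v /= v0 [A mA <-]].
  pose E := g_sigma_algebraType (sigma_gen `[0, +oo[ W).
  have mWE u : 0 <= u -> measurable_fun setT (W u : E -> R).
    move=> u0 _ B mB; apply: sub_sigma_algebra; exists u; last by exists B.
    by rewrite /= in_itv/= u0.
  have : measurable_fun setT (later W s v : E -> R).
    apply: measurable_funB; apply: mWE => //; rewrite addr_ge0//.
    by move: v0; rewrite in_itv/= andbT.
  by move=> /(_ measurableT A mA).
apply: independent_systemsS (@g_sigmaU_sub _ _) (@subset_refl _ _) _.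
have mWall := g_sigma_sub_measurable (sigma_gen_W_measurable (@subset_refl _ `[0, +oo[%classic)).
have mTall : <<s sigma_gen setT T >> `<=` measurable.
  by apply: g_sigma_sub_measurable; exact: sigma_gen_measurable.
apply: independent_systems3.
- exact: smallest_sigma_algebra.
- exact: smallest_sigma_algebra.
- exact: subset_trans subW mWall.
- exact: mTall.
- exact: subset_trans subF mWall.
- move=> A B C FA FB FC; rewrite setIAC independent_W_arrivals//; last first.
    by apply: (sigma_algebraI (@smallest_sigma_algebra _ _ _)); [exact: subW|exact: subF].
  by rewrite (brownian_past_future W_brownian s0)// muleAC.
- by move=> A B FA FB; rewrite independent_W_arrivals//; exact: subW.
Qed.

Lemma independent_past_interarrival k :
  independent_systems P <<s path_and_arrivals k >> <<s sigma_gen [set k] interarrival >>.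
Proof.
have subT : <<s sigma_gen [set j | (j <= k)%N] T >> `<=` <<s sigma_gen setT T >>.
  by apply: sub_sigma_algebra2 => A [v _ h]; exists v.
have subF : <<s sigma_gen [set k] interarrival >> `<=` <<s sigma_gen setT T >>.
  apply: smallest_sub; first exact: smallest_sigma_algebra.
  move=> _ [v /= v0 [A mA <-]].
  pose E := g_sigma_algebraType (sigma_gen setT T).
  have mTE u : measurable_fun setT (T u : E -> R).
    by move=> _ B mB; apply: sub_sigma_algebra; exists u => //; exists B.
  have : measurable_fun setT (interarrival v : E -> R) by exact: measurable_funB.
  by move=> /(_ measurableT A mA).
apply: independent_systemsS (@g_sigmaU_sub _ _) (@subset_refl _ _) _.
have mTall : <<s sigma_gen setT T >> `<=` measurable.
  by apply: g_sigma_sub_measurable; exact: sigma_gen_measurable.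
apply: independent_systems3.
- exact: smallest_sigma_algebra.
- exact: smallest_sigma_algebra.
- exact: (g_sigma_sub_measurable (sigma_gen_W_measurable (@subset_refl _ `[0, +oo[%classic))).
- exact: subset_trans subT mTall.
- exact: subset_trans subF mTall.
- move=> A B C FA FB FC; rewrite -setIA independent_W_arrivals//; last first.
    by apply: (sigma_algebraI (@smallest_sigma_algebra _ _ _)); [exact: subT|exact: subF].
  by rewrite (independent_arrivals_interarrival FB FC) muleA.
- by move=> A B FA FB; rewrite independent_W_arrivals//; exact: subT.
Qed.

Lemma renewal_count_sigma_gen (F : set_system Om) t A : sigma_algebra setT F ->
  sigma_gen setT T `<=` F -> 0 <= t -> F (N t @^-1` A).
Proof.
move=> sF FT t0; apply: renewal_count_sigma => // k c; apply: FT.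
exists k => //; exists `]-oo, c]%classic => //; rewrite setTI.
by apply/seteqP; split => w /=; rewrite in_itv.
Qed.

(* The past at [s] is enlarged by all the arrivals, so that events on the next
   interarrival time can be intersected with [A]; it remains independent of the
   increments of [W] after [s]. *)
Lemma stopped_past k A s : stopped_sigma_algebra G (T k) A ->
  <<s past_and_arrivals s >> (A `&` [set w | T k w < s]).
Proof.
apply: (@stopped_sub _ _ _ W T T0 Tlt past_and_arrivals) => //.
- move=> t B [|]; last exact: sigma_gen_measurable.
  by apply: sigma_gen_W_measurable; exact: subset_itvl.
- move=> u t ut B [[v + h]|h]; last by right.
  rewrite /= in_itv/= => /andP[v0 vu]; left; exists v => //.
  by rewrite /= in_itv/= v0 (le_trans vu).
- move=> t B t0 mB; apply: sub_sigma_algebra; left; exists t.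
    by rewrite /= in_itv/= t0 lexx.
  by exists B => //; rewrite setTI.
- move=> t B t0; apply: (renewal_count_sigma_gen (F := <<s past_and_arrivals t >>)) => //.
  by move=> C TC; apply: sub_sigma_algebra; right.
Qed.

(** The sets that coincide with a member of the smaller sigma-algebra on the given event form a
    sigma-algebra, so only generators need checking. *)
Let trace k s A :
  <<s sigma_gen `[0, +oo[ W `|` sigma_gen `[0, s] N >> A ->
  exists2 A', <<s path_and_arrivals k >> A' &
    A `&` [set w | T k w <= s /\ s < T k.+1 w] =
    A' `&` [set w | T k w <= s /\ s < T k.+1 w].
Proof.
set Q := [set w | _ /\ _].
have sL := @smallest_sigma_algebra _ setT (path_and_arrivals k).
suff : <<s sigma_gen `[0, +oo[ W `|` sigma_gen `[0, s] N >> `<=`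
  [set A | exists2 A', <<s path_and_arrivals k >> A' & A `&` Q = A' `&` Q] by exact.
apply: smallest_sub.
  split.
  - by exists set0 => //; exact: (sigma_algebra_set0 sL).
  - move=> B [B' LB' BB']; exists (~` B'); first exact: (sigma_algebra_setC sL).
    rewrite setTD; apply/seteqP; split => w [nB Qw]; split => // B'w.
      by apply: nB; have [] : (B `&` Q) w by rewrite BB'.
    by apply: nB; have [] : (B' `&` Q) w by rewrite -BB'.
  - move=> B hB; exists (\bigcup_n projT1 (cid2 (hB n))).
      by apply: (sigma_algebra_countable_bigcup sL) => n; case: cid2.
    rewrite !setI_bigcupl; apply: eq_bigcupr => n _.
    by case: cid2.
move=> B [BW|[v /= + [C mC <-]]].
  by exists B => //; apply: sub_sigma_algebra; left.
rewrite in_itv/= setTI => /andP[v0 vs]; apply: renewal_count_trace => //.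
move=> j c jk; apply: sub_sigma_algebra; right; exists j => //.
exists `]-oo, c]%classic => //; rewrite setTI.
by apply/seteqP; split => w /=; rewrite in_itv.
Qed.

(* At a time [q] with [T k < q < T k.+1] the count up to [q] is a function of
   [T 0, ..., T k]; the proof lets a rational [q] decrease to [T k]. *)
Lemma stopped_path k A : stopped_sigma_algebra G (T k) A ->
  <<s path_and_arrivals k >> A.
Proof.
move=> hA; pose S s := sigma_gen `[0, +oo[ W `|` sigma_gen `[0, s] N.
have AS s : <<s S s >> (A `&` [set w | T k w < s]).
  apply: (@stopped_sub _ _ _ W T T0 Tlt S) hA => //.
  - move=> t B [|[v + [C _ <-]]]; first exact: sigma_gen_W_measurable.
    rewrite /= in_itv/= setTI => /andP[v0 _].
    apply: renewal_count_sigma_gen => //; first exact: sigma_algebra_measurable.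
    exact: sigma_gen_measurable.
  - move=> u t ut B [h|[v + h]]; first by left.
    rewrite /= in_itv/= => /andP[v0 vu]; right; exists v => //.
    by rewrite /= in_itv/= v0 (le_trans vu).
  - move=> t B t0 mB; apply: sub_sigma_algebra; left; exists t.
      by rewrite /= in_itv/= t0.
    by exists B => //; rewrite setTI.
  - move=> t B t0; apply: sub_sigma_algebra; right; exists t.
      by rewrite /= in_itv/= t0 lexx.
    by exists B => //; rewrite setTI.
pose A' q := projT1 (cid2 (trace k (AS q))).
have LA' q : <<s path_and_arrivals k >> (A' q) by rewrite /A'; case: cid2.
have A'E q w : T k w < q -> q < T k.+1 w -> A' q w <-> A w.
  move=> h1 h2; rewrite /A'; case: cid2 => /= B LB AB; split => [Bw|Aw].
    have : (B `&` [set w | T k w <= q /\ q < T k.+1 w]) w by split => //; split => //; exact: ltW.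
    by rewrite -AB => -[[]].
  suff : (B `&` [set w | T k w <= q /\ q < T k.+1 w]) w by case.
  by rewrite -AB; split => //; split => //; exact: ltW.
(* In words of limits: for every rational [p > 0] some rational [q] between [T k] and [T k + p] has
   [A' q]. The formula avoids [T k.+1]; a [p] below the interarrival time forces [q < T k.+1]. *)
rewrite (_ : A = ~` \bigcup_(p : rat) (if 0 < (ratr p : R) then
    ~` \bigcup_(q : rat) (T k @^-1` `](ratr q - ratr p), (ratr q)[ `&` A' (ratr q)) else set0)).
  have sL := @smallest_sigma_algebra _ setT (path_and_arrivals k).
  apply: (sigma_algebra_setC sL); apply: (sigma_algebra_countable_bigcup sL) => p.
  case: ifP => _; last exact: (sigma_algebra_set0 sL).
  apply: (sigma_algebra_setC sL); apply: (sigma_algebra_countable_bigcup sL) => q.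
  apply: (sigma_algebraI sL) => //; apply: sub_sigma_algebra; right.
  exists k; first by rewrite /= leqnn.
  by eexists; last by rewrite setTI.
apply/seteqP; split => w.
  move=> Aw [p _]; case: ifPn => // p0; apply.
  have : T k w < Num.min (T k w + ratr p) (T k.+1 w).
    by rewrite lt_min ltrDl p0 Tlt.
  move=> /rat_in_itvoo[q]; rewrite in_itv/= lt_min => /and3P[q1 q2 q3].
  exists q => //; split; first by rewrite /= in_itv/= ltrBlDr q2 q1.
  exact/A'E.
move=> nA; apply: contrapT => Aw; apply: nA.
have : 0 < T k.+1 w - T k w by rewrite subr_gt0.
move=> /rat_in_itvoo[p]; rewrite in_itv/= => /andP[p0 p1].
exists p => //; rewrite p0 => -[q _ [/=]]; rewrite in_itv/= ltrBlDr => /andP[q2 q1].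
have q3 : ratr q < T k.+1 w.
  by apply: (lt_trans q2); rewrite -ltrBrDl.
by move=> /(A'E _ _ q1 q3).
Qed.

(** * The path of [W] after an arrival *)

Definition post_path (s : R) (w : Om) : cpath R := to_path (post W s w).

Lemma post_pathE s w v : 0 <= s -> post_path s w v = W (s + Num.max 0 v) w - W s w.
Proof. by move=> s0; rewrite /post_path to_pathE//; exact: continuous_post. Qed.

Let W_path w (u : R) : 0 <= u -> W u w = post_path 0 w u.
Proof. by move=> u0; rewrite post_pathE// W0 subr0 add0r max_r. Qed.

Lemma measurable_post_path0 : measurable_fun setT (post_path 0 : Om -> path_space R).
Proof.
apply: measurable_path => v; rewrite (_ : (fun w => _) = W (Num.max 0 v)).
  by apply: mW; rewrite le_max lexx.
by apply/funext => w; rewrite post_pathE// W0 subr0 add0r.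
Qed.

Lemma measurable_post_path (s : Om -> R) : measurable_fun setT s -> (forall w, 0 <= s w) ->
  measurable_fun setT ((fun w => post_path (s w) w) : Om -> path_space R).
Proof.
move=> ms s0; apply: measurable_path => v.
rewrite (_ : (fun w => _) = (fun w => post_path 0 w (s w + Num.max 0 v)) \-
    (fun w => post_path 0 w (s w))).
  apply: measurable_funB.
    apply: measurable_path_eval; last exact: measurable_post_path0.
    exact: measurable_funD.
  by apply: measurable_path_eval => //; exact: measurable_post_path0.
apply/funext => w; rewrite post_pathE//= (@W_path w (s w)) ?(@W_path w (s w + Num.max 0 v))//.
by rewrite addr_ge0// le_max lexx.
Qed.

Lemma post_path_law s B C : 0 <= s -> <<s past_and_arrivals s >> B -> measurable C ->
  P (B `&` post_path s @^-1` (C : set (path_space R))) =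
  (P B * P (post_path 0 @^-1` C))%E.
Proof.
move=> s0 FB mC.
have mall : past_and_arrivals s `<=` measurable.
  move=> A [|]; last exact: sigma_gen_measurable.
  by apply: sigma_gen_W_measurable; exact: subset_itvl.
apply: (@pi_system_law _ _ _ P _ (path_space R) (cylinder setT (@path_at R))) mC => //.
- by rewrite g_sigma_cylinder.
- exact: cylinder_setI_closed.
- exact: (g_sigma_sub_measurable mall).
- by apply: (@measurable_post_path (cst s)) => //.
- exact: measurable_post_path0.
move=> {}C [S [A [uS _ mA ->]]].
(* Paths live on all of [R] and are constant before [0]; replacing [v] by [Num.max 0 v] gives a
   cylinder over nonnegative times, to which the Brownian shift applies. *)
pose D : set (R -> R) := [set x | forall v, v \in S -> A v (x (Num.max 0 v))].
have cylD : cylinder `[0, +oo[ (fun v (x : R -> R) => x v) D.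
  rewrite /D; elim: S {uS D} => [|u S IH].
    rewrite (_ : [set x | forall v, v \in [::] -> _] = setT); first exact: cylinderT.
    by apply/seteqP; split.
  rewrite (_ : [set x | forall v, v \in u :: S -> _] = ((fun x => x (Num.max 0 u)) @^-1` A u) `&`
      [set x | forall v, v \in S -> A v (x (Num.max 0 v))]).
    apply: cylinder_setI_closed => //.
    apply: (@cylinder1 _ _ _ _ _ (fun v (x : R -> R) => x v)) => //.
    by rewrite /= in_itv/= andbT le_max lexx.
  apply/seteqP; split => [x h|x [h1 h2] v].
    split; first by apply: h; rewrite mem_head.
    by move=> v vS; apply: h; rewrite inE vS orbT.
  by rewrite inE => /orP[/eqP ->//|/h2].
have preE u : 0 <= u -> post_path u @^-1` (\bigcap_(i in [set` S]) path_at i @^-1` A i) =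
    (fun w v => later W u v w) @^-1` D.
  move=> u0; apply/seteqP; split => w h v /= vS; have := h v vS.
    by rewrite /path_at /= post_pathE.
  by rewrite /path_at/= post_pathE.
rewrite !preE// (independent_past_future s0) => //.
  rewrite (brownian_shift_law W_brownian s0)// -(brownian_shift_law W_brownian (lexx 0))//.
have : (fun w v => later W s v w) @^-1` D =
    \bigcap_(v in [set` S]) (later W s (Num.max 0 v) @^-1` A v).
  by apply/seteqP; split => w.
move=> ->; rewrite bigcap_seq big_seq.
apply: (@bigsetI_measurable _ (g_sigma_algebraType _)) => v vS.
apply: sub_sigma_algebra; exists (Num.max 0 v).
  by rewrite /= in_itv/= andbT le_max lexx.
by exists (A v) => //; rewrite setTI.
Qed.

Lemma integral_post_path s B (F : path_space R -> R) : 0 <= s ->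
  <<s past_and_arrivals s >> B -> measurable_fun setT F -> (forall x, 0 <= F x) ->
  (\int[P]_(w in B) (F (post_path s w))%:E =
   \int[P]_(w in B) \int[P]_w' (F (post_path 0 w'))%:E)%E.
Proof.
move=> s0 FB mF F0.
have mall : past_and_arrivals s `<=` measurable.
  move=> A [|]; last exact: sigma_gen_measurable.
  by apply: sigma_gen_W_measurable; exact: subset_itvl.
have mB : measurable B by exact: (g_sigma_sub_measurable mall).
have m1 : measurable_fun setT (\1_B : Om -> R) by exact: measurable_indic.
have msP : measurable_fun setT (post_path s : Om -> path_space R).
  by apply: (@measurable_post_path (cst s)) => //.
(* The absolute value keeps [f] nonnegative for every real first component; that component will be
   the indicator of [B]. *)
pose f (x : R * path_space R) := (`|x.1| * F x.2)%:E.
have := @freezing _ Om R P _ _ _ (path_space R) (\1_B : Om -> R) (post_path s) (post_path 0) f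
  m1 msP measurable_post_path0.
rewrite /f/= => h.
rewrite integral_mkcond [RHS]integral_mkcond.
transitivity (\int[P]_w (`|\1_B w| * F (post_path s w))%:E)%E.
  apply: eq_integral => w _; rewrite patchE indicE; case: ifPn => wB.
    by rewrite normr1 mul1r.
  by rewrite normr0 mul0r.
rewrite h; first last.
- by move=> x; rewrite lee_fin mulr_ge0.
- apply/measurable_EFinP; apply: measurable_funM.
    by apply: measurableT_comp => //.
  by apply: measurableT_comp => //.
- move=> A C mA mC; apply: post_path_law => //.
  pose E : measurableType _ := g_sigma_algebraType (past_and_arrivals s).
  have : measurable_fun setT (\1_(B : set E) : E -> R) by exact: measurable_indic.
  by move=> /(_ measurableT A mA); rewrite setTI.
apply: eq_integral => w _; rewrite patchE indicE; case: ifPn => wB.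
  by under eq_integral do rewrite normr1 mul1r.
by under eq_integral do rewrite normr0 mul0r; rewrite integral0.
Qed.

Let B_measurable k A D : stopped_sigma_algebra G (T k) A -> measurable D ->
  measurable (A `&` interarrival k @^-1` D).
Proof.
move=> [mA _] mD; apply: measurableI => //; rewrite -[X in measurable X]setTI.
by apply: measurable_interarrival.
Qed.

(* The arrival time [T k] rounded up to the next multiple of [1 / (n + 1)]. *)
Definition arrival_above k n w : R := (Num.truncn (n.+1%:R * T k w)).+1%:R / n.+1%:R.

Lemma arrival_above_bounds k n w : T k w < arrival_above k n w <= T k w + n.+1%:R^-1.
Proof.
have nT0 : 0 <= n.+1%:R * T k w by rewrite mulr_ge0// (arrival_ge0 (T0 w) Tlt).
have /andP[h1 h2] := truncn_itv nT0.
rewrite /arrival_above ltr_pdivlMr ?ltr0n// ler_pdivrMr ?ltr0n// [T k w * _]mulrC h2/=.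
by rewrite mulrDl mulVf ?pnatr_eq0// [T k w * _]mulrC -natr1 lerD2r.
Qed.

Lemma arrival_above_ge0 k n w : 0 <= arrival_above k n w.
Proof. by rewrite /arrival_above divr_ge0. Qed.

Lemma arrival_above_cvg k w : arrival_above k n w @[n --> \oo] --> T k w.
Proof.
apply: (@squeeze_cvgr _ _ _ _ (cst (T k w)) (fun n => T k w + harmonic n)).
- by apply: nearW => n /=; have /andP[/ltW -> ->] := arrival_above_bounds k n w.
- exact: cvg_cst.
- rewrite -[X in _ --> X]addr0; apply: cvgD; first exact: cvg_cst.
  exact: cvg_harmonic.
Qed.

Let truncn_setE k n i : [set w | Num.truncn (n.+1%:R * T k w) = i] =
  T k @^-1` `[i%:R / n.+1%:R, i.+1%:R / n.+1%:R[.
Proof.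
apply/seteqP; split => w /=; rewrite in_itv/= ler_pdivrMr ?ltr0n// ltr_pdivlMr ?ltr0n//.
  have nT0 : 0 <= n.+1%:R * T k w by rewrite mulr_ge0// (arrival_ge0 (T0 w) Tlt).
  by move=> <-; rewrite [T k w * _]mulrC truncn_itv.
by rewrite [T k w * _]mulrC => h; exact: truncn_def.
Qed.

Lemma measurable_arrival_above k n : measurable_fun setT (arrival_above k n).
Proof.
move=> _ E mE; rewrite setTI.
rewrite (_ : _ @^-1` E = \bigcup_i ([set w | Num.truncn (n.+1%:R * T k w) = i] `&`
  [set w | E (i.+1%:R / n.+1%:R)])).
  apply: bigcupT_measurable => i; apply: measurableI.
    by rewrite truncn_setE -[X in measurable X]setTI; exact: mT.
  have [h|h] := pselect (E (i.+1%:R / n.+1%:R)).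
    by rewrite (_ : [set w | _] = setT)//; apply/seteqP; split.
  by rewrite (_ : [set w | _] = set0)//; apply/seteqP; split.
apply/seteqP; split => w /=; last by case=> i _ [/= <-].
by move=> h; exists (Num.truncn (n.+1%:R * T k w)).
Qed.

Lemma integral_above k A D n (F : path_space R -> R) :
  stopped_sigma_algebra G (T k) A -> measurable D ->
  measurable_fun setT F -> (forall x, 0 <= F x) ->
  (\int[P]_(w in A `&` interarrival k @^-1` D) (F (post_path (arrival_above k n w) w))%:E =
   \int[P]_(w in A `&` interarrival k @^-1` D) \int[P]_w' (F (post_path 0 w'))%:E)%E.
Proof.
move=> hA mD mF F0; set B := A `&` _.
have mB : measurable B by exact: B_measurable.
pose Bi i := B `&` [set w | Num.truncn (n.+1%:R * T k w) = i].
have BE : B = \bigcup_i Bi i.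
  apply/seteqP; split => [w Bw|w [i _ []]//].
  by exists (Num.truncn (n.+1%:R * T k w)).
have mBi i : measurable (Bi i).
  apply: measurableI => //; rewrite truncn_setE -[X in measurable X]setTI.
  exact: mT.
have tBi : trivIset setT Bi.
  by apply/trivIsetP => i j _ _ /eqP ij; apply/seteqP; split => // w [[_ /= ti] [_ /= tj]];
    apply: ij; rewrite -ti -tj.
have mpp : measurable_fun setT ((fun w => post_path (arrival_above k n w) w) : Om -> path_space R).
  by apply: measurable_post_path; [exact: measurable_arrival_above|exact: arrival_above_ge0].
rewrite BE ge0_integral_bigcup//; last 2 first.
- by apply/measurable_EFinP; apply: measurable_funTS; apply: measurableT_comp mpp.
- by move=> w _; rewrite lee_fin.
rewrite ge0_integral_bigcup//; last by move=> w _; apply: integral_ge0 => w' _; rewrite lee_fin.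
apply: eq_eseriesr => i _.
have si0 : 0 <= i.+1%:R / n.+1%:R :> R by rewrite divr_ge0.
(* On the slice [Bi i] the rounded time is a constant strictly above [T k], as [stopped_past]
   requires, and the constraint on the interarrival time is allowed because the past contains all
   arrivals. *)
have sBi : <<s past_and_arrivals (i.+1%:R / n.+1%:R) >> (Bi i); last first.
  apply: etrans (integral_post_path si0 sBi mF F0).
  by apply: eq_integral => w; rewrite inE /Bi/= => -[_ ti]; rewrite /arrival_above ti.
have -> : Bi i = (A `&` [set w | T k w < i.+1%:R / n.+1%:R]) `&`
    (interarrival k @^-1` D `&` [set w | Num.truncn (n.+1%:R * T k w) = i]).
  apply/seteqP; split => [w [[Aw Dw] ti]|w [[Aw _] [Dw ti]]] //.
  split; [split => //|by []].
  have : (T k @^-1` `[i%:R / n.+1%:R, i.+1%:R / n.+1%:R[) w by rewrite -truncn_setE.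
  by rewrite /= in_itv/= => /andP[].
have sK := @smallest_sigma_algebra _ setT (past_and_arrivals (i.+1%:R / n.+1%:R)).
apply: (sigma_algebraI sK); first exact: (stopped_past hA).
have KT j E : measurable E -> <<s past_and_arrivals (i.+1%:R / n.+1%:R) >> (T j @^-1` E).
  move=> mE; apply: sub_sigma_algebra; right; exists j => //.
  by exists E => //; rewrite setTI.
apply: (sigma_algebraI sK); last by rewrite truncn_setE; exact: KT.
pose E : measurableType _ := g_sigma_algebraType (past_and_arrivals (i.+1%:R / n.+1%:R)).
have : measurable_fun setT (interarrival k : E -> R).
  by apply: measurable_funB => _ C mC; rewrite setTI; exact: KT.
by move=> /(_ measurableT D mD); rewrite setTI.
Qed.

(** The constraint [D] stays inside [B] while the path is treated: the identity at rounded times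
    passes to [T k] for soft cylinders by continuity of paths, then to ray cylinders as [m] grows,
    then to every [C]. Only afterwards is [P B] factored, by the independence of the interarrival
    time from [A], and [T 1] separated from [W]. *)
Lemma strong_markov_arrival k A D C :
  stopped_sigma_algebra G (T k) A -> measurable D -> measurable C ->
  P (A `&` interarrival k @^-1` D `&`
     (fun w => post_path (T k w) w) @^-1` (C : set (path_space R))) =
  (P A * P (T 1%N @^-1` D `&` post_path 0 @^-1` C))%E.
Proof.
move=> hA mD mC; set B := A `&` _.
have mA : measurable A by case: hA.
have mB : measurable B.
  by apply: measurableI => //; rewrite -[X in measurable X]setTI; exact: measurable_interarrival.
have mpk : measurable_fun setT ((fun w => post_path (T k w) w) : Om -> path_space R).
  exact: measurable_post_path.
have path_cvg w v : post_path (arrival_above k n w) w v @[n --> \oo] -->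
    post_path (T k w) w v.
  have a0 n := arrival_above_ge0 k n w.
  have max0 : 0 <= Num.max 0 v by rewrite le_max lexx.
  have cc := @cts_fun _ _ (post_path 0 w).
  rewrite (_ : (fun n => _) = fun n => post_path 0 w (arrival_above k n w + Num.max 0 v)
      - post_path 0 w (arrival_above k n w)); last first.
    by apply/funext => n; rewrite post_pathE// -!W_path ?addr_ge0.
  rewrite post_pathE// !W_path ?addr_ge0//; apply: cvgB; last first.
    apply: (@cvg_comp _ _ _ (fun n => arrival_above k n w) (post_path 0 w) _ (nbhs (T k w))).
      exact: arrival_above_cvg.
    exact: cc.
  apply: (@cvg_comp _ _ _ (fun n => arrival_above k n w + Num.max 0 v) (post_path 0 w)
    _ (nbhs (T k w + Num.max 0 v))); last exact: cc.
  by apply: cvgD; [exact: arrival_above_cvg|exact: cvg_cst].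
have mS m S X : measurable_fun setT (X : Om -> path_space R) ->
    measurable_fun setT (fun w => soft_cylinder m S (X w)).
  by move=> mX; exact: (measurableT_comp (@measurable_soft_cylinder R m S) mX).
have step1 m S : (\int[P]_(w in B) (soft_cylinder m S (post_path (T k w) w))%:E =
   \int[P]_(w in B) \int[P]_w' (soft_cylinder m S (post_path 0 w'))%:E)%E.
  have : ((\int[P]_(w in B) (soft_cylinder m S (post_path (arrival_above k n w) w))%:E)%E
     @[n --> \oo] --> (\int[P]_(w in B) (soft_cylinder m S (post_path (T k w) w))%:E)%E).
    apply: (@unit_bounded_cvg_integral _ _ _ P B
      (fun n w => soft_cylinder m S (post_path (arrival_above k n w) w))) => //.
    - move=> n; apply: mS; apply: measurable_post_path.
        exact: measurable_arrival_above.
      by move=> w; exact: arrival_above_ge0.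
    - by move=> n w; exact: soft_cylinder_01.
    - by move=> w; apply: soft_cylinder_cvg_path; exact: path_cvg.
  under eq_fun => n.
    rewrite (integral_above n hA mD
      (@measurable_soft_cylinder R m S)); last first.
      by move=> x; have /andP[] := soft_cylinder_01 m S x.
    over.
  by move=> /cvg_lim <- //; rewrite lim_cst.
have intI B' (X : Om -> path_space R) S : measurable B' -> measurable_fun setT X ->
    (\int[P]_(w in B') (\1_(ray_cylinder S) (X w))%:E = P (X @^-1` ray_cylinder S `&` B'))%E.
  move=> mB'' mX; have mSX : measurable (X @^-1` ray_cylinder S).
    by rewrite -[X in measurable X]setTI; apply: mX => //; exact: ray_cylinder_measurable.
  by rewrite -integral_indic.
have cvg_soft B' (X : Om -> path_space R) S : measurable B' -> measurable_fun setT X ->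
    ((\int[P]_(w in B') (soft_cylinder m S (X w))%:E)%E @[m --> \oo] -->
    P (X @^-1` ray_cylinder S `&` B')).
  move=> mB'' mX; rewrite -intI//.
  apply: (@unit_bounded_cvg_integral _ _ _ P B' (fun m w => soft_cylinder m S (X w))) => //.
  - by move=> m; exact: mS.
  - by move=> m w; exact: soft_cylinder_01.
  - by move=> w; exact: soft_cylinder_cvg_indic.
have PBfin : P B \is a fin_num by exact: fin_num_measure.
have ray S : P (B `&` (fun w => post_path (T k w) w) @^-1` ray_cylinder S) =
    (P B * P (post_path 0 @^-1` ray_cylinder S))%E.
  rewrite setIC muleC; have := cvg_soft B _ S mB mpk.
  under eq_fun do rewrite step1 integral_cst//.
  move=> /cvg_lim <- //; apply/cvg_lim => //.
  apply: cvgeZr => //; have := cvg_soft setT _ S measurableT measurable_post_path0.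
  by rewrite setIT.
have := @pi_system_law _ _ _ P _ _ _ B _ _ (ray_cylinder_generates R)
  (@ray_cylinder_setI_closed R) mB mpk measurable_post_path0.
move=> ->//; last by move=> _ [S _ <-]; exact: ray.
have WP : <<s sigma_gen `[0, +oo[ W >> (post_path 0 @^-1` C).
  pose E : measurableType _ := g_sigma_algebraType (sigma_gen `[0, +oo[ W).
  have : measurable_fun setT (post_path 0 : E -> path_space R).
    apply: measurable_path => v; rewrite (_ : (fun w => _) = W (Num.max 0 v)).
      move=> _ K mK; apply: sub_sigma_algebra; exists (Num.max 0 v).
        by rewrite /= in_itv/= andbT le_max lexx.
      by exists K.
    by apply/funext => w; rewrite post_pathE// W0 subr0 add0r.
  by move=> /(_ measurableT C mC); rewrite setTI.
have TD : <<s sigma_gen setT T >> (T 1%N @^-1` D).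
  by apply: sub_sigma_algebra; exists 1%N => //; exists D => //; rewrite setTI.
have PBE : P B = (P A * P (T 1%N @^-1` D))%E.
  rewrite -(P_interarrival k mD).
  apply: (independent_past_interarrival (k := k)).
    exact: (stopped_path hA).
  by apply: sub_sigma_algebra; exists k => //; exists D => //; rewrite setTI.
rewrite PBE [in RHS]setIC independent_W_arrivals//.
by rewrite -muleA; congr (_ * _)%E; rewrite muleC.
Qed.

(** * Measurability of the drawdowns with respect to the stopped sigma-algebras *)

Context (eta theta sigma : R).

Definition stopped_measurable k (Y : Om -> R) :=
  forall A, measurable A -> stopped_sigma_algebra G (T k) (Y @^-1` A).

Lemma stopped_measurable_fun k Y : stopped_measurable k Y -> measurable_fun setT Y.
Proof. by move=> sY _ A mA; rewrite setTI; case: (sY A mA). Qed.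

Section drawdown_at_arrivals.
Context (z : R) (b : nat -> Om -> R) (B : R -> Om -> R).
Hypothesis Bb : forall k t w, T k w <= t -> t < T k.+1 w -> B t w = b k w.

Let D k w := drawdown W T eta theta sigma z B (T k w) w.

Lemma drawdown_arrivalS k w : D k.+1 w =
  dd_step eta theta sigma (D k w) (b k w) (interarrival k w) (post_path (T k w) w).
Proof.
rewrite /D (drawdown_step eta theta sigma (@Wc w) (T0 w) Tlt (b := b^~ w)); last first.
  by move=> j t; exact: Bb.
apply: eq_dd_step; first by rewrite subr_ge0 ltW.
move=> s /andP[s0 _]; rewrite post_pathE//.
Qed.

Lemma drawdown_arrival0 w : D 0%N w = Num.max z 0.
Proof.
by rewrite /D; apply: drawdown_start.
Qed.

Lemma drawdown_arrival_ge0 k w : 0 <= D k w.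
Proof.
case: k => [|k]; first by rewrite drawdown_arrival0 le_max lexx orbT.
rewrite drawdown_arrivalS; apply: dd_step_ge0; first exact: cts_fun.
by rewrite subr_ge0 ltW.
Qed.

(* On [T k.+1 <= t] all the times involved may be capped at [t], which makes the
   drawdown at [T k.+1] a function of [W] up to [t]. *)
Lemma stopped_measurable_drawdown k :
  (forall j, (j < k)%N -> stopped_measurable j (b j)) -> stopped_measurable k (D k).
Proof.
elim: k => [_ A mA|k IH bm].
  rewrite (_ : D 0%N = cst (Num.max z 0)); last by apply/funext => w; rewrite drawdown_arrival0.
  have G0 t : 0 <= t -> sigma_algebra setT (G t) by exact: smallest_filtration_sigma.
  have [h|h] := pselect (A (Num.max z 0)).
    rewrite (_ : _ @^-1` _ = setT); last by apply/seteqP; split.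
    split => // t t0; rewrite setTI; exact: smallest_filtration_arrival.
  rewrite (_ : _ @^-1` _ = set0); last by apply/seteqP; split.
  split => // t t0; rewrite set0I; exact: (sigma_algebra_set0 (G0 t t0)).
have {IH}Dk : stopped_measurable k (D k).
  by apply: IH => j jk; apply: bm; exact: ltnW.
have bk := bm k (ltnSn k).
have DE : D k.+1 = fun w =>
    dd_step eta theta sigma (D k w) (b k w) (interarrival k w) (post_path (T k w) w).
  by apply/funext => w; exact: drawdown_arrivalS.
have tau0 w : 0 <= interarrival k w by rewrite subr_ge0 ltW.
move=> A mA; split.
  rewrite -[X in measurable X]setTI DE.
  apply: (measurable_dd_step eta theta sigma (stopped_measurable_fun Dk)
    (stopped_measurable_fun bk)) => //.
    exact: measurable_interarrival.
  exact: measurable_post_path.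
move=> t t0; have sG := smallest_filtration_sigma W N t0.
pose E : measurableType _ := g_sigma_algebraType (G t).
have EG : (measurable : set_system E) = G t by exact: sigma_algebra_id.
have TG j : G t [set w | T j w <= t] by exact: smallest_filtration_arrival.
(* Stopped measurability informs about [Y] at time [t] only where [T k w <= t]; elsewhere [Y] is set
   to [0]. *)
have patch Y : stopped_measurable k Y ->
    measurable_fun setT ((fun w => if T k w <= t then Y w else 0) : E -> R).
  move=> sY _ C mC; rewrite setTI EG.
  rewrite (_ : _ @^-1` C = (Y @^-1` C `&` [set w | T k w <= t]) `|`
     (if pselect (C 0) then ~` [set w | T k w <= t] else set0)).
    apply: (sigma_algebraU sG); first by have [_] := sY C mC; exact.
    case: pselect => /= [C0|nC0]; first exact: (sigma_algebra_setC sG (TG k)).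
    exact: (sigma_algebra_set0 sG).
  apply/seteqP; split => w /=.
    by case: ifPn => [|/negP] Tt CY; [left|right; case: pselect].
  case=> [[CY ->]//|]; case: pselect => //= C0; by case: ifPn.
pose S j w := Num.min (T j w) t.
have mS j : measurable_fun setT (S j : E -> R).
  move=> _ C mC; rewrite setTI EG.
  apply: (sigma_algebra_preimage_le sG) mC => c; rewrite /S.
  have [tc|ct] := leP t c.
    rewrite (_ : [set w | Num.min (T j w) t <= c] = setT); first exact: (sigma_algebra_setT sG).
    by apply/seteqP; split => w //= _; rewrite ge_min tc orbT.
  rewrite (_ : [set w | Num.min (T j w) t <= c] = [set w | T j w <= c]); last first.
    by apply/seteqP; split => w /=; rewrite ge_min leNgt (lt_geF ct) ?orbF.
  have [c0|c0] := leP 0 c; first by apply: smallest_filtration_arrival => //; exact: ltW.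
  rewrite (_ : [set w | T j w <= c] = set0); first exact: (sigma_algebra_set0 sG).
  apply/seteqP; split => w //= Tc; have := le_lt_trans (le_trans (Tk0 j w) Tc) c0.
  by rewrite ltxx.
have S0 j w : 0 <= S j w by rewrite /S le_min Tk0.
have St j w : S j w <= t by rewrite /S ge_min lexx orbT.
pose Wt w : path_space R := to_path (fun v => W (Num.min (Num.max 0 v) t) w).
have clip_ge0 v : 0 <= Num.min (Num.max 0 v) t by rewrite le_min t0 andbT le_max lexx.
have cclip (f : R -> R) : continuous f -> continuous (fun v => Num.min (Num.max 0 (f v)) t).
  move=> cf v; apply: (@continuous_min _ _ (fun v => Num.max 0 (f v)) (fun=> t)); last exact: cvg_cst.
  by apply: (@continuous_max _ _ (fun=> 0) f); [exact: cvg_cst|exact: cf].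
have cW w (f : R -> R) : continuous f -> continuous (fun v => W (Num.min (Num.max 0 (f v)) t) w).
  move=> cf v; rewrite (_ : (fun v => _) = fun v => post_path 0 w (Num.min (Num.max 0 (f v)) t)).
    apply: (@continuous_comp _ _ _ (fun v => Num.min (Num.max 0 (f v)) t)); first exact: cclip.
    exact: cts_fun.
  by apply/funext => u; rewrite W_path.
have WtE w v : Wt w v = W (Num.min (Num.max 0 v) t) w.
  by rewrite /Wt to_pathE//; apply: cW => u; exact: cvg_id.
have mWt : measurable_fun setT (Wt : E -> path_space R).
  apply: measurable_path => v; rewrite (_ : (fun w => _) = W (Num.min (Num.max 0 v) t)).
    move=> _ C mC; rewrite setTI EG; apply: smallest_filtrationW => //.
    by rewrite ge_min lexx orbT.
  by apply/funext => w; rewrite WtE.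
(* The path after [T k] with every time capped at [t]: it uses [W] only up to [t], and where
   [T k.+1 w <= t] it agrees with [post_path] up to the interarrival time. *)
pose X w : path_space R := to_path (fun v =>
  W (Num.min (Num.max 0 (S k w + Num.max 0 v)) t) w - W (S k w) w).
have XE w v : X w v = W (Num.min (Num.max 0 (S k w + Num.max 0 v)) t) w - W (S k w) w.
  rewrite /X to_pathE// => u; apply: cvgB; last exact: cvg_cst.
  apply: (cW w (fun u => S k w + Num.max 0 u)) => {}u; apply: cvgD; first exact: cvg_cst.
  by apply: (@continuous_max _ _ (fun=> 0) id); [exact: cvg_cst|exact: cvg_id].
have mX : measurable_fun setT (X : E -> path_space R).
  apply: measurable_path => v.
  rewrite (_ : (fun w => _) = (fun w => Wt w (S k w + Num.max 0 v)) \- (fun w => Wt w (S k w))).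
    apply: measurable_funB; apply: measurable_path_eval => //.
    exact: measurable_funD.
  apply/funext => w; rewrite XE/= !WtE [Num.max 0 (S k w)]max_r// [Num.min (S k w) t]min_l//.
have mdd := measurable_dd_step eta theta sigma (patch _ Dk) (patch _ bk)
  (measurable_funB (mS k.+1) (mS k)) mX.
have tauS w : 0 <= S k.+1 w - S k w.
  by rewrite subr_ge0 /S le_min !ge_min lexx orbT andbT (ltW (Tlt k w)).
pose F w := dd_step eta theta sigma
    (if T k w <= t then D k w else 0) (if T k w <= t then b k w else 0)
    (S k.+1 w - S k w) (X w).
have mF : G t (F @^-1` A) by have := mdd tauS measurableT A mA; rewrite setTI EG.
suff -> : D k.+1 @^-1` A `&` [set w | T k.+1 w <= t] = F @^-1` A `&` [set w | T k.+1 w <= t].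
  exact: (sigma_algebraI sG mF (TG k.+1)).
have ddE w : T k.+1 w <= t -> D k.+1 w = F w.
  move=> Tt; have Tt' : T k w <= t by rewrite (le_trans _ Tt)// ltW.
  rewrite DE /F Tt' /S !min_l//; apply: eq_dd_step => // v /andP[v0 vt].
  rewrite post_pathE// XE /S (min_l Tt') max_r//.
  rewrite [Num.max 0 (_ + _)]max_r ?addr_ge0// min_l//.
  by rewrite (le_trans _ Tt)// -lerBrDl.
by apply/seteqP; split => w /= [h Tt]; split => //; move: h; rewrite /= ddE.
Qed.

End drawdown_at_arrivals.

Lemma stopped_sigma_algebra_sigma k :
  sigma_algebra setT (stopped_sigma_algebra G (T k)).
Proof.
split.
- split => // t t0; rewrite set0I.
  exact: (sigma_algebra_set0 (smallest_filtration_sigma W N t0)).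
- move=> A [mA AG]; split; first by rewrite setTD; exact: measurableC.
  move=> t t0; have sG := smallest_filtration_sigma W N t0.
  rewrite (_ : _ `&` _ = [set w | T k w <= t] `&` ~` (A `&` [set w | T k w <= t])).
    apply: (sigma_algebraI sG); first exact: smallest_filtration_arrival.
    by apply: (sigma_algebra_setC sG); exact: AG.
  by apply/seteqP; split => [w [[_ nA] Tt]|w [Tt nA]]; split => //; [case|split => // Aw; exact: nA].
- move=> A hA; split; first by apply: bigcupT_measurable => n; case: (hA n).
  move=> t t0; have sG := smallest_filtration_sigma W N t0.
  rewrite setI_bigcupl; apply: (sigma_algebra_countable_bigcup sG) => n.
  by case: (hA n) => _; exact.
Qed.

Lemma stopped_measurable_arrival k : stopped_measurable k (T k).
Proof.
have sS := stopped_sigma_algebra_sigma k.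
move=> A mA; apply: (sigma_algebra_preimage_le sS) mA => c; split.
  rewrite (_ : [set w | _] = T k @^-1` `]-oo, c]); last first.
    by apply/seteqP; split => w /=; rewrite in_itv.
  by rewrite -[X in measurable X]setTI; exact: mT.
move=> t t0.
rewrite (_ : _ `&` _ = [set w | T k w <= Num.min c t]); last first.
  by apply/seteqP; split => w /=; rewrite le_min => /andP.
have [c0|c0] := leP 0 (Num.min c t).
  by apply: smallest_filtration_arrival => //; rewrite ge_min lexx orbT.
rewrite (_ : [set w | _] = set0).
  exact: (sigma_algebra_set0 (smallest_filtration_sigma W N t0)).
apply/seteqP; split => w //= Tc; have := le_lt_trans (le_trans (Tk0 k w) Tc) c0.
by rewrite ltxx.
Qed.

Context (dcrit r : R).

Let mp0 := measurable_post_path0.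

(** * Controlled chain of drawdowns *)

Definition continuation (u : R -> \bar R) (z b : R) : \bar R :=
  (\int[P]_w ((expR (- r * T 1%N w))%:E *
     u (dd_step eta theta sigma z b (T 1%N w) (post_path 0 w))))%E.

(** [Num.max 0] makes the duration nonnegative on the whole product space, as [measurable_dd_step]
    demands; interarrival times are unaffected. *)
Lemma measurable_dd_kernel (u : R -> \bar R) : measurable_fun setT u ->
  measurable_fun setT (fun p : (R * R) * (R * path_space R) => 
    u (dd_step eta theta sigma p.1.1 p.1.2 (Num.max 0 p.2.1) p.2.2)).
Proof.
move=> mu; apply: (measurableT_comp mu).
apply: measurable_dd_step; last by move=> p; rewrite le_max lexx.
- exact: measurableT_comp measurable_fst measurable_fst.
- exact: measurableT_comp measurable_snd measurable_fst.
- apply: measurable_maxr => //.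
  exact: measurableT_comp measurable_fst measurable_snd.
- exact: measurableT_comp measurable_snd measurable_snd.
Qed.

Lemma measurable_continuation (u : R -> \bar R) : measurable_fun setT u ->
  (forall x, 0 <= u x)%E ->
  measurable_fun setT (fun p : R * R => continuation u p.1 p.2).
Proof.
move=> mu u0.
pose f (q : (R * R) * Om) := ((expR (- r * T 1%N q.2))%:E *
     u (dd_step eta theta sigma q.1.1 q.1.2 (T 1%N q.2) (post_path 0 q.2)))%E.
apply: (@measurable_fun_fubini_tonelli_F _ _ (R * R)%type Om R P f).
  apply: emeasurable_funM.
    apply/measurable_EFinP; apply: measurableT_comp => //; apply: measurable_funM => //.
    by apply: measurableT_comp => //.
  apply: (measurableT_comp mu); apply: measurable_dd_step => //.
  - exact: measurableT_comp measurable_fst measurable_fst.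
  - exact: measurableT_comp measurable_snd measurable_fst.
  - exact: measurableT_comp.
  - exact: (measurableT_comp measurable_post_path0 measurable_snd).
by move=> q; rewrite mule_ge0// lee_fin expR_ge0.
Qed.

Section strategy_step.
Context (z : R) (b : nat -> Om -> R) (B : R -> Om -> R).
Hypothesis Bb : forall k t w, T k w <= t -> t < T k.+1 w -> B t w = b k w.
Hypothesis bm : forall k, stopped_measurable k (b k).

Local Notation D k w := (drawdown W T eta theta sigma z B (T k w) w).

Let Dm k : stopped_measurable k (fun w => D k w).
Proof.
apply: (stopped_measurable_drawdown z Bb).
by move=> j _; exact: bm.
Qed.

(** [T k], the drawdown and the decision are measurable for the stopped sigma-algebra, so by the
    strong Markov property they can be frozen while the next interarrival time and path are replaced
    by [T 1] and [W]. *)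
Lemma one_step k (u : R -> \bar R) : measurable_fun setT u -> (forall x, 0 <= u x)%E ->
  (\int[P]_w ((expR (- r * T k.+1 w))%:E * u (D k.+1 w)) =
   \int[P]_w ((expR (- r * T k w))%:E * continuation u (D k w) (b k w)))%E.
Proof.
move=> mu u0.
pose X w := (T k w, (D k w, b k w)).
pose Y w : R * path_space R := (interarrival k w, post_path (T k w) w).
pose Y' w : R * path_space R := (T 1%N w, post_path 0 w).
have mY' : measurable_fun setT Y' by apply: measurable_fun_pair.
have mY : measurable_fun setT Y.
  apply: measurable_fun_pair; first exact: measurable_interarrival.
  exact: measurable_post_path.
have mX : measurable_fun setT X.
  apply: measurable_fun_pair => //; apply: measurable_fun_pair.
    exact: (stopped_measurable_fun (Dm k)).
  exact: (stopped_measurable_fun (bm k)).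
pose f (p : (R * (R * R)) * (R * path_space R)) : \bar R :=
  ((expR (- r * (p.1.1 + p.2.1)))%:E *
   u (dd_step eta theta sigma p.1.2.1 p.1.2.2 (Num.max 0 p.2.1)%R p.2.2))%E.
have mf : measurable_fun setT f.
  apply: emeasurable_funM.
    apply/measurable_EFinP; apply: measurableT_comp => //; apply: measurable_funM => //.
    by apply: measurable_funD; apply: measurableT_comp.
  pose g (p : (R * (R * R)) * (R * path_space R)) := (p.1.2, p.2).
  apply: (measurableT_comp (measurable_dd_kernel mu) (_ : measurable_fun setT g)).
  apply: measurable_fun_pair => //.
  exact: measurableT_comp measurable_snd measurable_fst.
have f0 : (forall p, 0 <= f p)%E by move=> p; rewrite mule_ge0// lee_fin expR_ge0.
have XY A C : measurable A -> measurable C ->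
    P (X @^-1` A `&` Y @^-1` C) = (P (X @^-1` A) * P (Y' @^-1` C))%E.
  move=> mA mC.
  have sX : stopped_sigma_algebra G (T k) (X @^-1` A).
    have sS := stopped_sigma_algebra_sigma k.
    pose E : measurableType _ := g_sigma_algebraType (stopped_sigma_algebra G (T k)).
    have ES : (measurable : set_system E) = stopped_sigma_algebra G (T k).
      exact: sigma_algebra_id.
    have mE (Z : Om -> R) : stopped_measurable k Z -> measurable_fun setT (Z : E -> R).
      by move=> sZ _ F mF; rewrite setTI ES; exact: sZ.
    have mXE : measurable_fun setT (X : E -> _).
      apply: measurable_fun_pair; first by apply: mE; exact: stopped_measurable_arrival.
      by apply: measurable_fun_pair; exact: mE.
    by have := mXE measurableT A mA; rewrite setTI ES.
  apply: (@pi_system_law _ _ _ P _ _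
    [set A `*` B | A in (measurable : set_system R) & B in (measurable : set_system (path_space R))]) => //.
  - exact: measurable_prod_measurableType.
  - move=> _ _ [A1 mA1 [B1 mB1 <-]] [A2 mA2 [B2 mB2 <-]].
    exists (A1 `&` A2); first exact: measurableI.
    by exists (B1 `&` B2); [exact: measurableI|rewrite setXI].
  - by rewrite -[X in measurable X]setTI; exact: mX.
  - move=> _ [A1 mA1 [B1 mB1 <-]].
    have := strong_markov_arrival sX mA1 mB1.
    by rewrite -setIA.
have := freezing mX mY mY' XY mf f0; rewrite /f/=.
have Tmax w : Num.max 0 (T 1%N w) = T 1%N w by rewrite max_r.
have taumax w : Num.max 0 (interarrival k w) = interarrival k w.
  by rewrite max_r// subr_ge0 ltW.
move=> h; apply: etrans; last first.
  apply: etrans h _; apply: eq_integral => w _.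
  rewrite /continuation -ge0_integralZl//; last 2 first.
  - apply: emeasurable_funM.
      apply/measurable_EFinP; apply: measurableT_comp => //; exact: measurable_funM.
    apply: (measurableT_comp mu); apply: measurable_dd_step => //.
  - by move=> w' _; rewrite mule_ge0// lee_fin expR_ge0.
  apply: eq_integral => w' _; rewrite muleA -EFinM -expRD -mulrDr Tmax.
  by [].
apply: eq_integral => w _; rewrite taumax -(drawdown_arrivalS _ Bb).
by rewrite /interarrival addrC subrK.
Qed.

End strategy_step.

Lemma strategy_step B : strategy W T B -> exists b : nat -> Om -> R,
  [/\ forall k t w, T k w <= t -> t < T k.+1 w -> B t w = b k w,
      forall k, stopped_measurable k (b k) & forall k w, 0 <= b k w <= 1].
Proof.
case=> b [bm b01 Bb]; exists b; split => // k t w h1 h2.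
by rewrite Bb ?(le_trans (Tk0 k w))// /step_process (renewal_countE Tlt h1 h2).
Qed.

Section feedback.
Variables (bs : R -> R) (z : R).
Hypothesis bs_measurable : measurable_fun (`[0, +oo[%classic : set R) bs.
Hypothesis bs_range : forall x, 0 <= x -> 0 <= bs x <= 1.
Let Bs := feedback_strategy W T eta theta sigma bs z.
Local Notation D k w := (drawdown W T eta theta sigma z Bs (T k w) w).

Lemma feedback_step k t w : T k w <= t -> t < T k.+1 w -> Bs t w = bs (D k w).
Proof.
move=> h1 h2; rewrite /Bs feedback_strategyE//.
by rewrite (renewal_countE Tlt h1 h2).
Qed.

(** The drawdown at [T k] depends on earlier decisions only, hence the strong induction. As [bs] is
    measurable on [[0, +oo[], nonnegativity of drawdowns enters. *)
Lemma stopped_measurable_feedback k : stopped_measurable k (fun w => bs (D k w)).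
Proof.
elim/ltn_ind: k => k IH A mA.
have := stopped_measurable_drawdown z feedback_step IH.
have D0 w : 0 <= D k w.
  exact: (drawdown_arrival_ge0 z feedback_step).
move=> /(_ _ (bs_measurable (measurable_itv _) mA)).
rewrite (_ : _ @^-1` (_ `&` _) = (fun w => bs (D k w)) @^-1` A)//.
by apply/seteqP; split => [w [] //|w bA]; split => //; rewrite /= in_itv/= D0.
Qed.

Lemma feedback_strategy_strategy : strategy W T Bs.
Proof.
have bE k w : feedback_prefix W T eta theta sigma bs z k.+1 k w = bs (D k w).
  rewrite -(feedback_step (lexx (T k w)))// /Bs /feedback_strategy /step_process.
  by rewrite (renewal_count_arrival Tlt).
exists (fun k => feedback_prefix W T eta theta sigma bs z k.+1 k); split => //.
- move=> k; rewrite (_ : feedback_prefix _ _ _ _ _ _ _ k.+1 k = fun w => bs (D k w)).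
    exact: stopped_measurable_feedback.
  by apply/funext => w; exact: bE.
- move=> k w; rewrite bE; apply: bs_range.
  exact: (drawdown_arrival_ge0 z feedback_step).
Qed.

End feedback.

Lemma constant_strategy z b : 0 <= z ->
  discounted_value P W T eta theta sigma dcrit r z b =
  continuation (value P W T eta theta sigma dcrit r) z b.
Proof.
move=> z0; apply: eq_integral => w _.
have cst_step k t w' : T k w' <= t -> t < T k.+1 w' ->
  (fun _ _ => b : R) t w' = (fun _ _ => b) k w' by [].
have e0 : drawdown W T eta theta sigma z (fun _ _ => b) (T 0%N w) w = z.
  by apply: etrans (drawdown_arrival0 _ _ _) _; exact: max_l.
have eT : interarrival 0 w = T 1%N w by rewrite /interarrival T0 subr0.
have eS := drawdown_arrivalS z cst_step 0 w.
by rewrite eS e0 eT T0.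
Qed.

(** * Discounting and bounds on the cost of a strategy *)

Definition discount : \bar R := (\int[P]_w (expR (- r * T 1%N w))%:E)%E.
Local Notation phi := discount.

Let mexp k : measurable_fun setT (fun w => (expR (- r * T k w))%:E).
Proof.
by apply/measurable_EFinP; apply: measurableT_comp => //; exact: measurable_funM.
Qed.

Let exp0 k w : (0 <= (expR (- r * T k w))%:E)%E.
Proof. by rewrite lee_fin expR_ge0. Qed.

Hypothesis r_gt0 : 0 < r.

Lemma discount_fin : phi \is a fin_num.
Proof.
rewrite /discount ge0_fin_numE; last exact: integral_ge0.
apply: (@le_lt_trans _ _ (\int[P]_w (cst 1%E w))%E).
  apply: ge0_le_integral => //.
  move=> w _; rewrite lee_fin -expR0 ler_expR mulNr oppr_le0.
  by rewrite mulr_ge0// ltW.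
by rewrite integral_cst//= mul1e probability_setT ltry.
Qed.

Lemma discount_ge0 : (0 <= phi)%E. Proof. exact: integral_ge0. Qed.

(** Since [T 1 > 0] everywhere, [1 - expR (- r * T 1)] is strictly positive, and so is its
    integral. *)
Lemma discount_lt1 : (phi < 1)%E.
Proof.
have T1 w : 0 < T 1%N w by rewrite -(T0 w).
have e1 w : expR (- r * T 1%N w) < 1.
  by rewrite -expR0 ltr_expR mulNr oppr_lt0 mulr_gt0.
pose f w := (1 - expR (- r * T 1%N w))%:E.
have mf : measurable_fun setT f.
  by apply/measurable_EFinP; apply: measurable_funB => //; apply/measurable_EFinP; exact: mexp.
have f0 w : (0 <= f w)%E by rewrite lee_fin subr_ge0 ltW.
have fphi : (\int[P]_w f w + phi = 1)%E.
  rewrite /discount -ge0_integralD//.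
  transitivity (\int[P]_w cst 1%E w)%E; last by rewrite integral_cst//= mul1e probability_setT.
  by apply: eq_integral => w _; rewrite /f -EFinD subrK.
have If0 : (0 < \int[P]_w f w)%E.
  rewrite lt0e integral_ge0// andbT; apply/eqP => If.
  have : (\int[P]_w `|f w| = 0)%E.
    by under eq_integral do rewrite gee0_abs//.
  move=> /(ae_eq_integral_abs P measurableT mf).1 [A [mA PA fA]].
  have AT : A = setT.
    apply/seteqP; split => // w _; apply: fA => /= /(_ I) /eqP.
    by rewrite eqe subr_eq0 => /eqP e; have := e1 w; rewrite -e ltxx.
  have {}PA : P A = 0%E := PA.
  by move/eqP: PA; rewrite AT probability_setT onee_eq0.
by rewrite -fphi lteDr// discount_fin.
Qed.

Definition penalty (x : R) : R := if dcrit < x then 1 else 0.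

Lemma penalty_ge0 x : 0 <= penalty x. Proof. by rewrite /penalty; case: ifP. Qed.

Lemma le_penalty x y : x <= y -> penalty x <= penalty y.
Proof.
rewrite /penalty => xy; case: ifPn => [dx|_]; last by case: ifP.
by rewrite (lt_le_trans dx xy).
Qed.

Lemma measurable_penalty : measurable_fun setT penalty.
Proof. by apply: nondecreasing_measurable => // x y; exact: le_penalty. Qed.

Section cost_bounds.
Context (z : R) (b : nat -> Om -> R) (B : R -> Om -> R).
Hypothesis Bb : forall k t w, T k w <= t -> t < T k.+1 w -> B t w = b k w.
Hypothesis bm : forall k, stopped_measurable k (b k).
Local Notation D k w := (drawdown W T eta theta sigma z B (T k w) w).

Let mD k : measurable_fun setT (fun w => D k w).
Proof.
apply: (@stopped_measurable_fun k).
by apply: (stopped_measurable_drawdown _ Bb).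
Qed.

Let C k : \bar R := (\int[P]_w ((expR (- r * T k w))%:E * (penalty (D k w))%:E))%E.
Let A (u : R -> \bar R) k : \bar R := (\int[P]_w ((expR (- r * T k w))%:E * u (D k w)))%E.
Let E k : \bar R := (\int[P]_w (expR (- r * T k w))%:E)%E.

Let mpen k : measurable_fun setT (fun w => (penalty (D k w))%:E).
Proof. by apply/measurable_EFinP; exact: (measurableT_comp measurable_penalty). Qed.

Let pen0 k w : (0 <= (penalty (D k w))%:E)%E.
Proof. by rewrite lee_fin penalty_ge0. Qed.

Lemma cost_series : cost P W T eta theta sigma dcrit r B z = (\sum_(0 <= k <oo) C k)%E.
Proof.
rewrite /C -integral_nneseries//; last 2 first.
- by move=> k; exact: emeasurable_funM.
- by move=> k w _; rewrite mule_ge0.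
apply: eq_integral => w _; apply: eq_eseriesr => k _.
by rewrite /penalty -EFinM; case: ifP; rewrite ?mulr1 ?mulr0.
Qed.

Lemma discounted_step (u : R -> \bar R) k : measurable_fun setT u ->
  (forall x, 0 <= u x)%E ->
  A u k.+1 = (\int[P]_w ((expR (- r * T k w))%:E * continuation u (D k w) (b k w)))%E.
Proof. by move=> mu u0; exact: one_step. Qed.

(** This is the one-step identity for the constant function [1], whose continuation value is
    [phi]. *)
Lemma discount_pow k : E k = ((fine phi) ^+ k)%:E.
Proof.
elim: k => [|k IH].
  rewrite /E; transitivity (\int[P]_w cst 1%E w)%E; last by rewrite integral_cst//= mul1e probability_setT.
  by apply: eq_integral => w _; rewrite T0 mulr0 expR0.
have := @discounted_step (cst 1%E) k (@measurable_cst _ _ _ _ _ _) (fun _ => lee01).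
rewrite /A; under eq_integral do rewrite mule1.
rewrite -/(E k.+1) => ->.
transitivity (\int[P]_w ((expR (- r * T k w))%:E * (fine phi)%:E))%E.
  apply: eq_integral => w _; congr (_ * _)%E; rewrite fineK ?discount_fin//.
  by apply: eq_integral => w' _; rewrite mule1.
rewrite ge0_integralZr//; last by rewrite lee_fin fine_ge0 ?discount_ge0.
by rewrite -/(E k) IH -EFinM exprSr.
Qed.

Let mu_cont (u : R -> \bar R) k : measurable_fun setT u -> (forall x, 0 <= u x)%E ->
  measurable_fun setT (fun w => continuation u (D k w) (b k w)).
Proof.
move=> mu u0.
have mc := measurable_continuation mu u0.
have mDb : measurable_fun setT (fun w => (D k w, b k w)).
  by apply: measurable_fun_pair => //; exact: (stopped_measurable_fun (bm k)).
exact: (measurableT_comp mc mDb).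
Qed.

Let A0 (u : R -> \bar R) : A u 0 = u (Num.max z 0).
Proof.
rewrite /A; transitivity (\int[P]_w cst (u (Num.max z 0)%R) w)%E; last first.
  by rewrite integral_cst//= probability_setT mule1.
apply: eq_integral => w _; have e := drawdown_arrival0 z B w.
by rewrite e T0 mulr0 expR0 mul1e.
Qed.

Let cont0 (u : R -> \bar R) x y : (forall x, 0 <= u x)%E -> (0 <= continuation u x y)%E.
Proof. by move=> u0; apply: integral_ge0 => w _; rewrite mule_ge0. Qed.

(** Iterating [n] times leaves the remainder [A u n], which is at most [M * phi ^ n] and vanishes
    because [phi < 1]. *)
Lemma cost_lower (u : R -> \bar R) M : measurable_fun setT u ->
  (forall x, 0 <= u x <= M%:E)%E ->
  (forall k w, u (D k w) <= (penalty (D k w))%:E + continuation u (D k w) (b k w))%E ->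
  (u (Num.max z 0)%R <= cost P W T eta theta sigma dcrit r B z)%E.
Proof.
move=> mu uM uD; have u0 x : (0 <= u x)%E by have /andP[] := uM x.
have C0 k : (0 <= C k)%E by apply: integral_ge0 => w _; rewrite mule_ge0.
have step k : (A u k <= C k + A u k.+1)%E.
  rewrite discounted_step// /C -ge0_integralD//; last 4 first.
  - by move=> w _; rewrite mule_ge0.
  - by apply: emeasurable_funM.
  - by move=> w _; rewrite mule_ge0// cont0.
  - by apply: emeasurable_funM => //; exact: mu_cont.
  apply: ge0_le_integral => //.
  - by move=> w _; rewrite mule_ge0.
  - by apply: emeasurable_funM => //; exact: (measurableT_comp mu).
  - apply: emeasurable_funD; first exact: emeasurable_funM.
    by apply: emeasurable_funM => //; exact: mu_cont.
  - by move=> w _; rewrite -ge0_muleDr// ?cont0//; exact: lee_wpmul2l.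
have bound := le_partial_sum step.
have AM n : (A u n <= (M * (fine phi) ^+ n)%R%:E)%E.
  have M0 : (0 <= M%:E)%E by have /andP[h1 h2] := uM 0; exact: le_trans h2.
  have -> : (M * (fine phi) ^+ n)%R%:E = (\int[P]_w ((expR (- r * T n w))%:E * M%:E))%E.
    by rewrite ge0_integralZr// -/(E n) discount_pow -EFinM mulrC.
  apply: ge0_le_integral => //.
  - by move=> w _; rewrite mule_ge0.
  - by apply: emeasurable_funM => //; exact: (measurableT_comp mu).
  - by apply: emeasurable_funM.
  - by move=> w _; apply: lee_wpmul2l => //; have /andP[] := uM (D n w).
have f01 : `|fine phi| < 1.
  rewrite ger0_norm ?fine_ge0 ?discount_ge0// -lte_fin fineK ?discount_fin//.
  exact: discount_lt1.
rewrite -A0 cost_series; apply/lee_addgt0Pr => e e0.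
have : geometric M (fine phi) n @[n --> \oo] --> 0 by exact: cvg_geometric.
move=> /cvgrPdist_le/(_ e e0)[n _ /(_ n (leqnn n))/=].
rewrite sub0r normrN => /(le_trans (ler_norm _)) Mn.
apply: le_trans (bound n) _; apply: leeD; first exact: nneseries_lim_ge.
by apply: le_trans (AM n) _; rewrite lee_fin.
Qed.

(** Here the remainder is nonnegative and dropped. The error at step [k] is discounted by [phi ^ k],
    whence the total [e / (1 - phi)]. *)
Lemma cost_upper (u : R -> \bar R) (e : R) : measurable_fun setT u -> 0 <= e ->
  (forall x, 0 <= u x)%E ->
  (forall k w, (penalty (D k w))%:E + continuation u (D k w) (b k w) <= u (D k w) + e%:E)%E ->
  (cost P W T eta theta sigma dcrit r B z <= u (Num.max z 0)%R + (e / (1 - fine phi))%:E)%E.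
Proof.
move=> mu e0 u0 uD.
have C0 k : (0 <= C k)%E by apply: integral_ge0 => w _; rewrite mule_ge0.
have step k : (C k + A u k.+1 <= A u k + (e * fine phi ^+ k)%R%:E)%E.
  rewrite discounted_step// EFinM -discount_pow -ge0_integralZl//.
  rewrite /C /A -!ge0_integralD//; last 8 first.
  - by move=> w _; rewrite mule_ge0.
  - by apply: emeasurable_funM => //; exact: (measurableT_comp mu).
  - by move=> w _; rewrite mule_ge0// lee_fin.
  - by apply: emeasurable_funM.
  - by move=> w _; rewrite mule_ge0.
  - by apply: emeasurable_funM.
  - by move=> w _; rewrite mule_ge0// cont0.
  - by apply: emeasurable_funM => //; exact: mu_cont.
  apply: ge0_le_integral => //.
  - by move=> w _; rewrite adde_ge0// mule_ge0// cont0.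
  - apply: emeasurable_funD; first exact: emeasurable_funM.
    by apply: emeasurable_funM => //; exact: mu_cont.
  - apply: emeasurable_funD.
      by apply: emeasurable_funM => //; exact: (measurableT_comp mu).
    exact: emeasurable_funM.
  - move=> w _; rewrite -ge0_muleDr// ?cont0// [X in (_ <= _ + X)%E]muleC -ge0_muleDr ?lee_fin//.
    exact: lee_wpmul2l.
have f1 : 0 < 1 - fine phi.
  by rewrite subr_gt0 -lte_fin fineK ?discount_fin// discount_lt1.
have f0 : 0 <= fine phi by rewrite fine_ge0 ?discount_ge0.
have bound := partial_sum_le f1 step.
rewrite -A0 cost_series; apply: lime_le; first exact: is_cvg_nneseries.
apply: nearW => n; apply: le_trans (bound n); rewrite -addeA leeDl//.
rewrite adde_ge0//; first by apply: integral_ge0 => w _; rewrite mule_ge0.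
by rewrite lee_fin divr_ge0 ?mulr_ge0 ?exprn_ge0// ltW.
Qed.

End cost_bounds.
Local Notation v := (value P W T eta theta sigma dcrit r).
Local Notation cost := (cost P W T eta theta sigma dcrit r).

Let mint (u : R -> \bar R) z b : measurable_fun setT u ->
  measurable_fun setT (fun w => (expR (- r * T 1%N w))%:E *
     u (dd_step eta theta sigma z b (T 1%N w) (post_path 0 w)))%E.
Proof.
move=> mu; apply: emeasurable_funM => //; apply: (measurableT_comp mu).
exact: measurable_dd_step.
Qed.

Lemma continuation_ge0 (u : R -> \bar R) z b : (forall x, 0 <= u x)%E ->
  (0 <= continuation u z b)%E.
Proof. by move=> u0; apply: integral_ge0 => w _; rewrite mule_ge0. Qed.

Lemma le_continuation (u u' : R -> \bar R) z z' b :
  measurable_fun setT u -> measurable_fun setT u' -> (forall x, 0 <= u x)%E ->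
  (forall x, u x <= u' x)%E -> {homo u' : x y / x <= y >-> (x <= y)%E} -> z <= z' ->
  (continuation u z b <= continuation u' z' b)%E.
Proof.
move=> mu mu' u0 uu' u'_mono zz'; apply: ge0_le_integral => //.
- by move=> w _; rewrite mule_ge0.
- exact: mint.
- exact: mint.
- move=> w _; apply: lee_wpmul2l => //; apply: le_trans (uu' _) _.
  by apply: u'_mono; exact: le_dd_step.
Qed.

Lemma continuation_bound (u : R -> \bar R) M z b : measurable_fun setT u ->
  (forall x, 0 <= u x <= M%:E)%E -> (continuation u z b <= (M * fine phi)%:E)%E.
Proof.
move=> mu uM; have u0 x : (0 <= u x)%E by have /andP[] := uM x.
have M0 : 0 <= M by rewrite -lee_fin; have /andP[h1 h2] := uM 0; exact: le_trans h2.
rewrite EFinM fineK ?discount_fin// muleC -ge0_integralZr//.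
apply: ge0_le_integral => //.
- by move=> w _; rewrite mule_ge0.
- exact: mint.
- exact: emeasurable_funM.
- move=> w _; apply: lee_wpmul2l => //.
  by have /andP[] := uM (dd_step eta theta sigma z b (T 1 w) (post_path 0 w)).
Qed.

(** * Value function *)

Definition bellman (u : R -> \bar R) (z : R) : \bar R :=
  ((penalty z)%:E + ereal_inf [set continuation u z b | b in `[0%R, 1%R]])%E.

(** The solution of [C = 1 + C * fine phi], so that a penalty of at most [1] plus a continuation of
    at most [C * fine phi] respects the bound again. *)
Let C := (1 - fine phi)^-1.

Let fphi1 : 0 < 1 - fine phi.
Proof. by rewrite subr_gt0 -lte_fin fineK ?discount_fin// discount_lt1. Qed.

Definition bounded_monotone (u : R -> \bar R) :=
  (forall x, (0 <= u x <= C%:E)%E) /\ {homo u : x y / x <= y >-> (x <= y)%E}.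

Let bounded_monotone_measurable u : bounded_monotone u -> measurable_fun setT u.
Proof. by case=> uC u_mono; exact: bounded_nondecreasing_emeasurable uC u_mono. Qed.

Lemma bellman_bounded_monotone u : bounded_monotone u -> bounded_monotone (bellman u).
Proof.
move=> ubm; have mu := bounded_monotone_measurable ubm; have [uC u_mono] := ubm.
have u0 x : (0 <= u x)%E by have /andP[] := uC x.
have i01 : `[0%R, 1%R]%classic (0 : R) by rewrite /= in_itv/= lexx ler01.
split => [x|x y xy].
  apply/andP; split.
    rewrite adde_ge0// ?lee_fin ?penalty_ge0//.
    by apply: le_ereal_inf_tmp => _ [b _ <-]; exact: continuation_ge0.
  have -> : C = 1 + C * fine phi.
    by rewrite /C; field; rewrite gt_eqF.
  rewrite EFinD leeD//; first by rewrite lee_fin /penalty; case: ifP.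
  apply: le_trans (continuation_bound x 0 mu uC).
  by apply: ereal_inf_lbound; exists 0.
apply: leeD; first by rewrite lee_fin le_penalty.
apply: le_ereal_inf_tmp => _ [b bi <-].
apply: (@le_trans _ _ (continuation u x b)); first by apply: ereal_inf_lbound; exists b.
exact: le_continuation.
Qed.

Lemma le_bellman u u' : bounded_monotone u -> bounded_monotone u' ->
  (forall x, u x <= u' x)%E -> forall x, (bellman u x <= bellman u' x)%E.
Proof.
move=> ubm ubm' uu' x; apply: leeD => //.
apply: le_ereal_inf_tmp => _ [b bi <-].
apply: (@le_trans _ _ (continuation u x b)); first by apply: ereal_inf_lbound; exists b.
apply: le_continuation => //; first exact: bounded_monotone_measurable.
- exact: bounded_monotone_measurable.
- by move=> y; have [/(_ y)/andP[]] := ubm.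
- by case: ubm'.
Qed.

(* Knaster-Tarski on the complete lattice of bounded nondecreasing functions,
   which yields a measurable fixed point without any continuity argument. *)
Lemma bellman_fixpoint : exists2 u, bounded_monotone u & forall x, u x = bellman u x.
Proof.
pose S := [set u | bounded_monotone u /\ forall x, (u x <= bellman u x)%E].
pose u x := ereal_sup [set f x | f in S].
have C0 : 0 <= C by rewrite invr_ge0 ltW.
have S0 : S (cst 0%E).
  have bm0 : bounded_monotone (cst 0%E) by split => // x; rewrite lexx lee_fin C0.
  split => // x; have [/(_ x)/andP[]] := bellman_bounded_monotone bm0.
  by [].
have le_u f x : S f -> (f x <= u x)%E by move=> Sf; apply: ereal_sup_ubound; exists f.
have ubm : bounded_monotone u.
  split => [x|x y xy].
    rewrite (le_u _ x S0)/=; apply: ge_ereal_sup => _ [f [[/(_ x)/andP[_ h] _] _] <-].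
    exact: h.
  apply: ge_ereal_sup => _ [f Sf <-]; have [[_ f_mono] _] := Sf.
  exact: le_trans (f_mono _ _ xy) (le_u _ y Sf).
have u_le x : (u x <= bellman u x)%E.
  apply: ge_ereal_sup => _ [f Sf <-]; have [fbm ff] := Sf.
  by apply: le_trans (ff x) _; apply: le_bellman => // y; exact: le_u.
exists u => // x; apply/eqP; rewrite eq_le u_le/=.
(* By monotonicity [bellman u] belongs to [S], so it lies below the supremum [u]. *)
apply: le_u; split; first exact: bellman_bounded_monotone.
apply: le_bellman => //; exact: bellman_bounded_monotone.
Qed.

Section fixpoint.
Variable u : R -> \bar R.
Hypothesis ubm : bounded_monotone u.
Hypothesis u_fix : forall x, u x = bellman u x.

Let mu : measurable_fun setT u. Proof. exact: bounded_monotone_measurable. Qed.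
Let u0 x : (0 <= u x)%E. Proof. by have [/(_ x)/andP[]] := ubm. Qed.

Lemma fixpoint_le_cost B z : strategy W T B -> (u (Num.max z 0)%R <= cost B z)%E.
Proof.
move=> /strategy_step[b [Bb bm b01]].
apply: (cost_lower Bb bm mu ubm.1) => k w.
rewrite {1}u_fix; apply: leeD => //; apply: ereal_inf_lbound.
by exists (b k w) => //; rewrite /= in_itv/= b01.
Qed.

Lemma feedback_cost_le (bs : R -> R) (z e : R) : 0 <= e -> measurable_fun (`[0, +oo[%classic : set R) bs ->
  (forall x, 0 <= x -> 0 <= bs x <= 1) ->
  (forall x : R, (0 <= x)%R -> (penalty x)%:E + continuation u x (bs x) <= u x + e%:E)%E ->
  (cost (feedback_strategy W T eta theta sigma bs z) z <=
   u (Num.max z 0)%R + (e / (1 - fine phi))%:E)%E.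
Proof.
move=> e0 mbs bs01 bs_opt.
have Bb := feedback_step bs z.
apply: (cost_upper Bb _ mu e0 u0).
  by move=> k; apply: stopped_measurable_feedback.
move=> k w; apply: bs_opt.
exact: (drawdown_arrival_ge0 z Bb).
Qed.

(** The lower bound holds for each strategy. For the upper bound no minimiser is available, and
    almost optimal selectors give feedback strategies of cost within any [e] of [u]. *)
Lemma value_fixpoint z : v z = u (Num.max z 0).
Proof.
apply/eqP; rewrite eq_le; apply/andP; split; last first.
  by apply: le_ereal_inf_tmp => _ [B sB <-]; exact: fixpoint_le_cost.
apply/lee_addgt0Pr => e e0.
(* The error per step is scaled so that its discounted total is [e]. *)
have e1 : 0 < e * (1 - fine phi) by rewrite mulr_gt0.
have hM x b : (0 <= continuation u x b <= (C * fine phi)%:E)%E.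
  by rewrite continuation_ge0//= continuation_bound//; case: ubm.
have h_mono b x y : x <= y -> (continuation u x b <= continuation u y b)%E.
  by move=> xy; apply: le_continuation => //; case: ubm.
have [s [ms s01 sP]] := monotone_selector e1 hM h_mono.
have := @feedback_cost_le s z _ (ltW e1) (measurable_funTS ms) (fun x _ => s01 x).
rewrite mulfK ?gt_eqF// => h; apply: le_trans (h _); last first.
  by move=> x _; rewrite u_fix /bellman -addeA leeD2l.
apply: ereal_inf_lbound; exists (feedback_strategy W T eta theta sigma s z) => //.
apply: feedback_strategy_strategy => //.
exact: measurable_funTS.
Qed.

End fixpoint.

End controlled_drawdown.

Theorem theorem2p9 (R : realType) (disp : measure_display)
  (Om : measurableType disp) (P : probability Om R)
  (W : R -> Om -> R) (T : nat -> Om -> R)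
  (eta theta sigma dcrit r : R) (bs : R -> R)
  (P_complete : measure_is_complete P)
  (W_brownian : brownian_motion P W)
  (T_renewal : renewal_arrivals P T)
  (WN_independent : independent_systems P
     (sigma_process `[0, +oo[ W) (sigma_process `[0, +oo[ (renewal_count T)))
  (eta_lt_theta : eta < theta)
  (sigma_gt0 : 0 < sigma)
  (dcrit_gt0 : 0 < dcrit)
  (r_gt0 : 0 < r)
  (bs_measurable : measurable_fun (`[0, +oo[%classic : set R) bs)
  (bs_range : forall z : R, 0 <= z -> 0 <= bs z <= 1)
  (bs_min : forall z : R, 0 <= z ->
     discounted_value P W T eta theta sigma dcrit r z (bs z) =
     ereal_inf [set discounted_value P W T eta theta sigma dcrit r z b
               | b in `[0, 1]]) :
  forall z : R, 0 <= z ->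
    let Bstar := feedback_strategy W T eta theta sigma bs z in
    strategy W T Bstar /\
    value P W T eta theta sigma dcrit r z =
    cost P W T eta theta sigma dcrit r Bstar z.
Proof.
move=> z z0 Bstar.
have sB : strategy W T Bstar.
  exact: (feedback_strategy_strategy W_brownian T_renewal).
split => //.
have [u ubm u_fix] :=
  bellman_fixpoint W_brownian T_renewal eta theta sigma dcrit r_gt0.
have vE := value_fixpoint W_brownian T_renewal WN_independent r_gt0 ubm u_fix.
have T0 w : T 1%N w >= 0.
  case: T_renewal => _ h0 hlt _ _; exact: (arrival_ge0 (h0 w) hlt).
(* Drawdowns are nonnegative, where the value function and [u] coincide; the minimality of [bs] thus
   transfers to [u]. *)
have contE x b : 0 <= x -> discounted_value P W T eta theta sigma dcrit r x b =
    continuation P W T eta theta sigma r u x b.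
  move=> x0; rewrite (constant_strategy W_brownian T_renewal)//.
  apply: eq_integral => w _; rewrite vE max_l//.
  by apply: dd_step_ge0 => //; exact: cts_fun.
(* The fixed-point equation turns minimality into the selector inequality with error [0], so the
   feedback cost is at most [u]. *)
have bs_opt x : 0 <= x -> ((penalty dcrit x)%:E +
    continuation P W T eta theta sigma r u x (bs x) <= u x + 0%:E)%E.
  move=> x0; rewrite adde0 [leRHS]u_fix /bellman -contE// bs_min//.
  rewrite leeD2l//; under eq_imagel do rewrite contE//.
  by [].
apply/eqP; rewrite eq_le; apply/andP; split; first by apply: ereal_inf_lbound; exists Bstar.
rewrite vE; have := feedback_cost_le W_brownian T_renewal WN_independent r_gt0 ubm z
  (lexx 0) bs_measurable bs_range bs_opt.
by rewrite mul0r adde0.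
Qed.
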